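(* Let $A$ be a finite dimensional quasi-hereditary algebra over a field with a simple preserving duality. Let $T$ be a faithful tilting $A$-module. Then $A$ has the double centralizer property with respect to $T$. In particular, the $T$-dominant dimension of $A$ (i.e. the dominant dimension of the left regular module ${}_AA$ relative to $T$) is at least two.
   Context: Let $K$ be a field and $A$ a finite dimensional unital $K$-algebra; modules are finite dimensional left modules (category $A$-mod). $\{L(\lambda)\mid\lambda\in\Lambda^+\}$ is a complete set of representatives of isomorphism classes of simple $A$-modules, and $A$ is assumed split, i.e. $\operatorname{End}_A(L(\lambda))=K$. $P(\lambda)$, $I(\lambda)$ are the projective cover and injective hull of $L(\lambda)$; $\operatorname{Tr}_M(N)$ is the sum of the images of all homomorphisms $M\to N$. Quasi-hereditary: there is a partial order $\preceq$ on $\Lambda^+$ such that, with $\Delta(\lambda):=P(\lambda)/\operatorname{Tr}_{\bigoplus_{\mu\succ\lambda}P(\mu)}(P(\lambda))$, for each $\lambda$ the kernel of $P(\lambda)\twoheadrightarrow\Delta(\lambda)$ has a filtration with subquotients $\Delta(\mu)$, $\mu\succ\lambda$, and the kernel of $\Delta(\lambda)\twoheadrightarrow L(\lambda)$ has a filtration with subquotients $L(\mu)$, $\mu\prec\lambda$. The costandard module $\nabla(\lambda)$ is the largest submodule of $I(\lambda)$ with no composition factor $L(\mu)$, $\mu\succ\lambda$. $\mathcal{F}(\Delta)$ (resp. $\mathcal{F}(\nabla)$) is the full subcategory of modules having a filtration with all subquotients of the form $\Delta(\lambda)$ (resp. $\nabla(\lambda)$). A tilting module is an object of $\mathcal{F}(\Delta)\cap\mathcal{F}(\nabla)$.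 Simple preserving duality: an exact, involutive, contravariant equivalence $\circ:A\text{-mod}\to A\text{-mod}$ which preserves the isomorphism classes of simple modules. Double centralizer property: the canonical algebra homomorphism $A\to\operatorname{End}_{\operatorname{End}_A(T)}(T)$ is surjective. For $X,T\in A$-mod, the dominant dimension of $X$ relative to $T$ is the supremum of all $n\in\mathbb{N}$ such that there is an exact sequence $0\to X\to T_1\to T_2\to\cdots\to T_n$ with all $T_i\in\operatorname{add}(T)$, where $\operatorname{add}(T)$ is the full subcategory of direct summands of finite direct sums of copies of $T$. *)

(* Defs.v *)
From HB Require Import structures.
From mathcomp Require Import all_boot all_order all_algebra all_field.
From mathcomp Require Import boolp classical_sets.

Set Implicit Arguments.
Unset Strict Implicit.
Unset Printing Implicit Defensive.

Import Order.TTheory GRing.Theory.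
Local Open Scope ring_scope.

Local Notation lfun_valE :=
  (comp_lfunE, add_lfunE, opp_lfunE, scale_lfunE, id_lfunE, zero_lfunE).

(* A finite dimensional left A-module is a finite dimensional K-space with a
   unital K-algebra morphism into its endomorphisms.  The multiplication of the
   library's algebra 'End(V) is reversed composition, whence \o below. *)
Record fdmod (K : fieldType) (A : falgType K) := FdMod {
  fdmod_sort :> vectType K;
  act : A -> 'End(fdmod_sort);
  act_is_linear : linear act;
  act1 : act 1 = \1%VF;
  actM : forall a b, act (a * b) = (act a \o act b)%VF }.

HB.instance Definition _ (K : fieldType) (A : falgType K) (M : fdmod A) :=
  GRing.isSemilinear.Build K A 'End(M) _ (act M)
    (GRing.semilinear_linear (@act_is_linear _ _ M)).

Section Modules.
Variables (K : fieldType) (A : falgType K).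
Implicit Types (M N Q : fdmod A) (a b : A).

Definition is_hom M N (f : 'Hom(M, N)) : Prop :=
  forall a v, f (act M a v) = act N a (f v).

Definition iso M N : Prop :=
  exists f : 'Hom(M, N), [/\ is_hom f, lker f = 0%VS & limg f = fullv].

Definition short_exact M N Q (f : 'Hom(M, N)) (g : 'Hom(N, Q)) : Prop :=
  [/\ is_hom f, is_hom g & [/\ lker f = 0%VS, limg f = lker g & limg g = fullv]].

Record submod M := Submod {
  submod_space :> {vspace M};
  submod_stable : forall a v, v \in submod_space -> act M a v \in submod_space }.

Section SubModule.
Variables (M : fdmod A) (U : submod M).

Definition sub_act a : 'End(subvs_of U) :=
  linfun (vsproj U \o act M a \o vsval : subvs_of U -> subvs_of U).

Lemma sub_actE a x : vsval (sub_act a x) = act M a (vsval x).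
Proof. by rewrite lfunE /= vsprojK // submod_stable // subvsP. Qed.

Lemma sub_act_linear : linear sub_act.
Proof.
move=> k a b; apply/lfunP=> x; apply: val_inj; rewrite /= !lfun_valE linearP /=.
by rewrite !sub_actE linearP /= !lfun_valE.
Qed.

Lemma sub_act1 : sub_act 1 = \1%VF.
Proof. by apply/lfunP=> x; apply: val_inj; rewrite /= sub_actE act1 !lfun_valE. Qed.

Lemma sub_actM a b : sub_act (a * b) = (sub_act a \o sub_act b)%VF.
Proof.
apply/lfunP=> x; apply: val_inj.
by rewrite /= lfun_valE !sub_actE actM lfun_valE.
Qed.

Definition subM : fdmod A := FdMod sub_act_linear sub_act1 sub_actM.

(* The quotient M / U lives on the library's complement of U; quot_pi is the
   canonical projection, with kernel U. *)
Definition quot_pi : 'Hom(M, subvs_of (U^C)%VS) :=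
  linfun (vsproj (U^C)%VS \o daddv_pi (U^C)%VS U).

Lemma capUC0 : ((U : {vspace M})^C :&: U = 0)%VS.
Proof. by rewrite capvC capv_compl. Qed.

Lemma val_quot_pi v : vsval (quot_pi v) = daddv_pi (U^C)%VS U v.
Proof. by rewrite lfunE /= vsprojK // memv_pi. Qed.

Lemma lker_quot_pi : lker quot_pi = U.
Proof.
apply/vspaceP=> v; rewrite memv_ker -(inj_eq val_inj) /= val_quot_pi.
have Hv : v \in ((U : {vspace M})^C + U)%VS.
  by rewrite addvC addv_complf memvf.
have E := daddv_pi_add capUC0 Hv.
apply/eqP/idP => [E0|vU]; first by rewrite -E E0 add0r memv_pi.
move: E; rewrite (daddv_pi_id _ vU) ?capv_compl // => /(canRL (addrK _)).
by rewrite subrr.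
Qed.

Lemma quot_piK x : quot_pi (vsval x) = x.
Proof.
by apply: val_inj; rewrite /= val_quot_pi daddv_pi_id ?capUC0 // subvsP.
Qed.

Lemma limg_quot_pi : limg quot_pi = fullv.
Proof.
by apply/vspaceP=> x; rewrite -(quot_piK x) memv_img ?memvf.
Qed.

Definition quot_act a : 'End(subvs_of (U^C)%VS) :=
  linfun (quot_pi \o act M a \o vsval : subvs_of (U^C)%VS -> subvs_of (U^C)%VS).

Lemma quot_pi_act a v : quot_pi (act M a v) = quot_act a (quot_pi v).
Proof.
rewrite [RHS]lfunE /= -/(quot_pi _); apply/eqP.
rewrite -subr_eq0 -!linearB -memv_ker lker_quot_pi submod_stable //.
have : v - vsval (quot_pi v) \in lker quot_pi.
  by rewrite memv_ker linearB /= quot_piK subrr.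
by rewrite lker_quot_pi.
Qed.

Lemma quot_act_linear : linear quot_act.
Proof.
move=> k a b; apply/lfunP=> x; rewrite -(quot_piK x) !lfun_valE.
by rewrite -!quot_pi_act linearP /= !lfun_valE linearP.
Qed.

Lemma quot_act1 : quot_act 1 = \1%VF.
Proof.
by apply/lfunP=> x; rewrite -(quot_piK x) -quot_pi_act act1 !lfun_valE.
Qed.

Lemma quot_actM a b : quot_act (a * b) = (quot_act a \o quot_act b)%VF.
Proof.
apply/lfunP=> x; rewrite -(quot_piK x) lfun_valE -!quot_pi_act actM.
by rewrite lfun_valE.
Qed.

Definition quotM : fdmod A := FdMod quot_act_linear quot_act1 quot_actM.

Definition quot_proj : 'Hom(M, quotM) := quot_pi.

Lemma quot_proj_hom : is_hom quot_proj.
Proof. exact: quot_pi_act. Qed.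

End SubModule.

Lemma ker_stable M N (f : 'Hom(M, N)) : is_hom f ->
  forall a v, v \in lker f -> act M a v \in lker f.
Proof. by move=> hf a v; rewrite !memv_ker hf => /eqP ->; rewrite linear0. Qed.

Definition kerS M N (f : 'Hom(M, N)) (hf : is_hom f) : submod M :=
  Submod (ker_stable hf).

Lemma zero_act_linear : linear (fun _ : A => 0 : 'End('rV[K]_0)).
Proof. by move=> k a b; rewrite scaler0 addr0. Qed.

Lemma zero_act1 : (0 : 'End('rV[K]_0)) = \1%VF.
Proof. by apply/lfunP=> x; apply/rowP; case. Qed.

Lemma zero_actM (a b : A) :
  (0 : 'End('rV[K]_0)) = ((0 : 'End('rV[K]_0)) \o (0 : 'End('rV[K]_0)))%VF.
Proof. by rewrite comp_lfun0l. Qed.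

Definition zeroM : fdmod A := FdMod zero_act_linear zero_act1 zero_actM.

Section DirectSum2.
Variables (M N : fdmod A).

Definition prod_fun a (x : M * N) : M * N := (act M a x.1, act N a x.2).

Lemma prod_fun_linear a : linear (prod_fun a).
Proof. by move=> k x y; rewrite /prod_fun /= !linearP. Qed.

HB.instance Definition _ a :=
  GRing.isSemilinear.Build K (M * N)%type (M * N)%type _ (prod_fun a)
    (GRing.semilinear_linear (prod_fun_linear a)).

Definition prod_act a : 'End((M * N)%type) := linfun (prod_fun a).

Lemma prod_act_linear : linear prod_act.
Proof.
move=> k a b; apply/lfunP=> x; rewrite !lfun_valE !lfunE /= /prod_fun.
by rewrite !linearP /= !lfun_valE.
Qed.

Lemma prod_act1 : prod_act 1 = \1%VF.
Proof.
by apply/lfunP=> -[x y]; rewrite lfunE /= /prod_fun !act1 !lfun_valE.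
Qed.

Lemma prod_actM a b : prod_act (a * b) = (prod_act a \o prod_act b)%VF.
Proof.
by apply/lfunP=> x; rewrite lfun_valE !lfunE /= /prod_fun !actM !lfun_valE.
Qed.

Definition prodM : fdmod A := FdMod prod_act_linear prod_act1 prod_actM.

End DirectSum2.

Definition dsum (s : seq (fdmod A)) : fdmod A := foldr prodM zeroM s.

Definition in_add (T M : fdmod A) : Prop :=
  exists (n : nat) (M' : fdmod A), iso (prodM M M') (dsum (nseq n T)).

Lemma reg_actM (a b : A) : amull (a * b) = (amull a \o amull b)%VF.
Proof. by apply/lfunP=> x; rewrite lfun_valE !lfunE /= mulrA. Qed.

Lemma reg_act_linear : linear (@amull K A).
Proof. exact: amull_is_linear. Qed.

Definition regM : fdmod A := FdMod reg_act_linear (amull1 A) reg_actM.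

Section Trace.
Variables (M N : fdmod A).

Definition comm_def a (f : 'Hom(M, N)) : 'Hom(M, N) :=
  (f \o act M a)%VF - (act N a \o f)%VF.

Lemma comm_def_linear a : linear (comm_def a).
Proof.
move=> k f g; apply/lfunP=> v.
by rewrite /comm_def !lfun_valE linearP /= scalerBr opprD addrACA.
Qed.

HB.instance Definition _ a :=
  GRing.isSemilinear.Build K 'Hom(M, N) 'Hom(M, N) _ (comm_def a)
    (GRing.semilinear_linear (comm_def_linear a)).

Definition homspace : {vspace 'Hom(M, N)} :=
  (\bigcap_(a <- vbasis {:A}) lker (linfun (comm_def a)))%VS.

Lemma homspaceP (f : 'Hom(M, N)) : (f \in homspace) <-> is_hom f.
Proof.
split=> [hf | hf]; last first.
  rewrite memvE /homspace; elim/big_ind: _ => [|U V fU fV|a _].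
  - exact: subvf.
  - by rewrite subv_cap fU.
  rewrite -memvE memv_ker lfunE /=; apply/eqP/lfunP=> v.
  by rewrite !lfun_valE hf subrr.
have hb a : a \in vbasis {:A} -> forall v, f (act M a v) = act N a (f v).
  move=> ab v; apply/eqP; rewrite -subr_eq0.
  suff /lfunP/(_ v) : comm_def a f = 0 by rewrite !lfun_valE => ->.
  apply/eqP; have : f \in lker (linfun (comm_def a)).
    move: hf; rewrite /homspace (big_rem a ab) /= memv_cap => /andP[] //.
  by rewrite memv_ker lfunE.
move=> a v; rewrite (coord_vbasis (memvf a)) !linear_sum /= !sum_lfunE.
rewrite linear_sum; apply: eq_bigr => i _; rewrite !linearZ /= !lfun_valE.
by rewrite linearZ /= hb // mem_nth ?size_tuple.
Qed.

(* Sum of the images of all homomorphisms; a basis of Hom_A(M, N) suffices,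
   see limg_trace and trace_min. *)
Definition traceV : {vspace N} :=
  (\sum_(f <- vbasis homspace) limg f)%VS.

Lemma limg_trace (f : 'Hom(M, N)) : is_hom f -> (limg f <= traceV)%VS.
Proof.
move=> /homspaceP hf; apply/subvP=> _ /memv_imgP[v _ ->].
rewrite (coord_vbasis hf) sum_lfunE memv_suml // => i _.
rewrite scale_lfunE memvZ // /traceV.
have ib : (vbasis homspace)`_i \in vbasis homspace.
  by rewrite mem_nth ?size_tuple.
by rewrite (big_rem _ ib) /= (subvP (addvSl _ _)) // memv_img ?memvf.
Qed.

Lemma trace_min (U : {vspace N}) :
  (forall f : 'Hom(M, N), is_hom f -> (limg f <= U)%VS) -> (traceV <= U)%VS.
Proof.
move=> hU; rewrite /traceV big_seq; elim/big_ind: _ => [|V W hV hW|f fb].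
- exact: sub0v.
- by rewrite subv_add hV.
by apply: hU; apply/homspaceP; apply: vbasis_mem.
Qed.

Lemma trace_stable a v : v \in traceV -> act N a v \in traceV.
Proof.
suff: (act N a @: traceV <= traceV)%VS.
  by move/subvP=> h vT; apply: h; apply: memv_img.
rewrite {1}/traceV limg_sum big_seq; elim/big_ind: _ => [|V W hV hW|f fb].
- exact: sub0v.
- by rewrite subv_add hV.
have hf : is_hom f by apply/homspaceP; apply: vbasis_mem.
apply/subvP=> _ /memv_imgP[_ /memv_imgP[w _ ->] ->]; rewrite -hf.
by rewrite (subvP (limg_trace hf)) // memv_img ?memvf.
Qed.

Definition trace : submod N := Submod trace_stable.

End Trace.

Definition simple M : Prop :=
  (fullv : {vspace M}) <> 0%VS /\
  forall U : submod M, (U : {vspace M}) = 0%VS \/ (U : {vspace M}) = fullv.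

Definition complete_simples (I : Type) (L : I -> fdmod A) : Prop :=
  [/\ forall i, simple (L i),
      forall i j, iso (L i) (L j) -> i = j
    & forall S, simple S -> exists i, iso S (L i)].

Definition End_is_scalar M : Prop :=
  forall f : 'End(M), is_hom f -> exists k : K, f = k *: \1%VF.

Definition projective (P : fdmod A) : Prop :=
  forall M N (g : 'Hom(M, N)) (f : 'Hom(P, N)),
    is_hom g -> limg g = fullv -> is_hom f ->
  exists2 h : 'Hom(P, M), is_hom h & (g \o h)%VF = f.

Definition injective_mod (I : fdmod A) : Prop :=
  forall M N (g : 'Hom(M, N)) (f : 'Hom(M, I)),
    is_hom g -> lker g = 0%VS -> is_hom f ->
  exists2 h : 'Hom(N, I), is_hom h & (h \o g)%VF = f.

Definition projective_cover (P M : fdmod A) (eps : 'Hom(P, M)) : Prop :=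
  [/\ projective P, is_hom eps, limg eps = fullv
    & forall U : submod P, (U + lker eps)%VS = fullv ->
        (U : {vspace P}) = fullv].

Definition injective_hull (M I : fdmod A) (iota : 'Hom(M, I)) : Prop :=
  [/\ injective_mod I, is_hom iota, lker iota = 0%VS
    & forall U : submod I, (U :&: limg iota)%VS = 0%VS ->
        (U : {vspace I}) = 0%VS].

(* filtration X M [:: i_n; ...; i_1] : there are submodules
   0 = M_0 <= M_1 <= ... <= M_n = M with M_j / M_(j-1) isomorphic to X i_j. *)
Inductive filtration (I : Type) (X : I -> fdmod A) :
    fdmod A -> seq I -> Prop :=
  | FiltZero M : (fullv : {vspace M}) = 0%VS -> filtration X M [::]
  | FiltStep M (U : submod M) i s :
      iso (quotM U) (X i) -> filtration X (subM U) s ->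
      filtration X M (i :: s).

Definition filtered (I : Type) (X : I -> fdmod A) M : Prop :=
  exists s, filtration X M s.

Section QuasiHereditary.
Variables (d : Order.disp_t) (Lam : finPOrderType d).
Variables (L P I : Lam -> fdmod A).

Definition std_kernel (l : Lam) : submod (P l) :=
  trace (dsum [seq P m | m <- enum Lam & (l < m)%O]) (P l).

Definition Delta (l : Lam) : fdmod A := quotM (std_kernel l).

(* The surjection Delta l -> L l is the map q induced by P l -> L l. *)
Definition quasi_hereditary (eps : forall l, 'Hom(P l, L l)) : Prop :=
  forall l,
    (exists2 s, filtration Delta (subM (std_kernel l)) s
              & all (fun m => (l < m)%O) s) /\
    (exists (q : 'Hom(Delta l, L l)) (hq : is_hom q),
       (q \o quot_proj (std_kernel l))%VF = eps l /\
       exists2 s, filtration L (subM (kerS hq)) s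
                & all (fun m => (m < l)%O) s).

(* For a complete set L of simples, filtration L M s means that s lists the
   factors of a composition series of M. *)
Definition comp_factor M (m : Lam) : Prop :=
  exists2 s, filtration L M s & m \in s.

Definition no_factor_above (l : Lam) M : Prop :=
  forall m, (l < m)%O -> ~ comp_factor M m.

Definition is_costandard (l : Lam) (U : submod (I l)) : Prop :=
  no_factor_above l (subM U) /\
  forall W : submod (I l), no_factor_above l (subM W) -> (W <= U)%VS.

Definition tilting (nabla : forall l, submod (I l)) (T : fdmod A) : Prop :=
  filtered Delta T /\ filtered (fun l => subM (nabla l)) T.

End QuasiHereditary.

(* A morphism of modules is a K-linear map satisfying is_hom, so the functor
   laws are only required of such maps; the values of fmap elsewhere are
   irrelevant. *)
Record contrafunctor := ContraFunctor {
  fobj :> fdmod A -> fdmod A;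
  fmap : forall M N, 'Hom(M, N) -> 'Hom(fobj N, fobj M);
  fmap_hom : forall M N (f : 'Hom(M, N)), is_hom f -> is_hom (fmap f);
  fmap_id : forall M, fmap (\1%VF : 'End(M)) = \1%VF;
  fmap_comp : forall M N Q (f : 'Hom(M, N)) (g : 'Hom(N, Q)),
    is_hom f -> is_hom g -> fmap (g \o f)%VF = (fmap f \o fmap g)%VF }.

(* Exact functors are additive. *)
Definition exact_functor (D : contrafunctor) : Prop :=
  (forall M N (f g : 'Hom(M, N)), is_hom f -> is_hom g ->
     fmap D (f + g) = fmap D f + fmap D g) /\
  (forall M N Q (f : 'Hom(M, N)) (g : 'Hom(N, Q)),
     short_exact f g -> short_exact (fmap D g) (fmap D f)).

Definition equivalence (D : contrafunctor) : Prop :=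
  [/\ forall M N (f g : 'Hom(M, N)), is_hom f -> is_hom g ->
        fmap D f = fmap D g -> f = g,
      forall M N (h : 'Hom(D N, D M)), is_hom h ->
        exists2 f : 'Hom(M, N), is_hom f & fmap D f = h
    & forall N, exists M, iso (D M) N].

(* D o D is naturally isomorphic to the identity. *)
Definition involutive_functor (D : contrafunctor) : Prop :=
  exists eta : forall M, 'Hom(M, D (D M)),
    (forall M, [/\ is_hom (eta M), lker (eta M) = 0%VS
                 & limg (eta M) = fullv]) /\
    (forall M N (f : 'Hom(M, N)), is_hom f ->
       (eta N \o f)%VF = (fmap D (fmap D f) \o eta M)%VF).

Definition simple_preserving_duality (D : contrafunctor) : Prop :=
  [/\ exact_functor D, involutive_functor D, equivalence D
    & forall S, simple S -> iso (D S) S].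

Definition faithful (T : fdmod A) : Prop := injective (act T).

(* Maps commuting with End_A(T) are automatically K-linear, since End_A(T)
   contains the scalars. *)
Definition double_centralizer (T : fdmod A) : Prop :=
  forall phi : 'End(T),
    (forall f : 'End(T), is_hom f -> (phi \o f)%VF = (f \o phi)%VF) ->
  exists a : A, phi = act T a.

(* The map f : X -> Y extends to an exact sequence
   X -> Y -> T_1 -> ... -> T_n (exact at Y, T_1, ..., T_(n-1)),
   with all T_i in add(T). *)
Fixpoint exact_from (T : fdmod A) (n : nat) (X Y : fdmod A) (f : 'Hom(X, Y)) :
    Prop :=
  if n is n'.+1 then
    exists (Z : fdmod A) (g : 'Hom(Y, Z)),
      [/\ in_add T Z, is_hom g, limg f = lker g & exact_from T n' g]
  else True.

(* 0 -> X -> T_1 -> ... -> T_n is exact *)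
Definition coresolution (T X : fdmod A) (n : nat) : Prop :=
  exact_from T n (0 : 'Hom(zeroM, X)).

End Modules.

(* None stands for infinity. *)
Definition enat_le (x y : option nat) : bool :=
  match x, y with
  | _, None => true
  | None, Some _ => false
  | Some m, Some n => (m <= n)%N
  end.

Definition enat_sup (S : nat -> Prop) (x : option nat) : Prop :=
  (forall n, S n -> enat_le (Some n) x) /\
  (forall y, (forall n, S n -> enat_le (Some n) y) -> enat_le x y).

Definition domdim (K : fieldType) (A : falgType K) (T X : fdmod A) :
    option nat :=
  xget None [set x | enat_sup (coresolution T X) x]%classic.

Lemma domdimP (K : fieldType) (A : falgType K) (T X : fdmod A) :
  enat_sup (coresolution T X) (domdim T X).
Proof.
apply: (@xgetPex _ None [set x | enat_sup (coresolution T X) x]%classic).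
set S := coresolution T X.
have [[b hb]|nb] := pselect (exists b, forall n, S n -> (n <= b)%N).
  have ex0 : exists n, `[< S n >] by exists 0%N; apply/asboolP.
  have ub n : `[< S n >] -> (n <= b)%N by move/asboolP; apply: hb.
  case: (ex_maxnP ex0 ub) => m /asboolP Sm hm; exists (Some m); split.
    by move=> n Sn; apply: hm; apply/asboolP.
  by move=> y; apply.
exists None; split=> [n _|[y|] hy] //.
by case: nb; exists y => n /hy.
Qed.

(* Main.v *)
(* Write E(M, N) for Ext^1(M, N) = 0, and nab = D Delta.  A module M lies in F(Delta) as
   soon as E(M, nab m) for all m.  If a faithful tilting module Z cogenerates all Delta(l)
   and generates all nab(l), embed A in a power of Z by a basis of Z: every map
   A -> nab(m) extends to the power, so the cokernel is in F(Delta), hence cogenerated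
   by Z, which yields both the double centralizer property and the exact sequence
   0 -> A -> Z_1 -> Z_2.

   By duality only cogeneration has to be shown for T and for D T.  It amounts to T
   having the indecomposable tilting module of highest weight l as a summand for each l
   for which Delta(l) contains a nonzero element annihilated by all non-split maps to
   tilting modules.  If that fails for some l, such an element of Delta(l) and its dual
   in nab(l) give a nonzero endomorphism commuting with End(Z), where
   Z = T + (other tilting modules) does satisfy the cogeneration condition; by the
   first part it is the action of an element of A, which kills T. *)
From HB Require Import structures.
Require Import Defs.
From mathcomp Require Import all_boot all_order all_algebra all_field.
From mathcomp Require Import boolp.

Set Implicit Arguments.
Unset Strict Implicit.
Unset Printing Implicit Defensive.

Import Order.TTheory GRing.Theory.
Local Open Scope ring_scope.
Local Notation lfun_valE :=
  (comp_lfunE, add_lfunE, opp_lfunE, scale_lfunE, id_lfunE, zero_lfunE).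

(** * Module homomorphisms *)

Section Homs.
Variables (K : fieldType) (A : falgType K).
Implicit Types (M N Q X Y Z : fdmod A).

(** Faithfulness alone gives no hold on a single weight l. It is exploited through the double
    centralizer property of the larger Z, which turns an endomorphism commuting with End(Z) into an
    element of A; so two maps, one at the socle of Delta(l) and one at the top of nab(l), have to
    vanish against the same complement. Duality provides this: having l as a summand means that some
    composite Delta(l) -> Z -> nab(l) is nonzero, a condition symmetric under D. Maximality of l
    among the missing weights keeps l missing when the other envelopes are added, because the
    envelope of m involves only weights at most m. The middle of the composite may be any K-linear
    map, since both of its ends already absorb End(Z). No decomposition into indecomposables is
    used: to have the indecomposable summand of weight l means that the inclusion of Delta(l) in its
    envelope factors through Z. Ext^1 appears only through its vanishing, stated as extendability of
    maps along short exact sequences. *)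

Record hom M N := MkHom { hom_fun :> 'Hom(M, N); homP : is_hom hom_fun }.

Definition mono M N (f : hom M N) := forall x, f x = 0 -> x = 0.
Definition epi M N (f : hom M N) := forall y, exists x, f x = y.
Definition exact M N Q (f : hom M N) (g : hom N Q) :=
  forall y, g y = 0 <-> exists x, f x = y.
Definition ses M N Q (f : hom M N) (g : hom N Q) :=
  [/\ mono f, epi g & exact f g].

Lemma homA M N (f : hom M N) a v : f (act M a v) = act N a (f v).
Proof. exact: homP. Qed.

Lemma hom0 M N (f : hom M N) : f 0 = 0. Proof. exact: linear0. Qed.
Lemma homD M N (f : hom M N) : {morph f : x y / x + y}.
Proof. exact: linearD. Qed.
Lemma homN M N (f : hom M N) : {morph f : x / - x}.
Proof. exact: linearN. Qed.
Lemma homB M N (f : hom M N) : {morph f : x y / x - y}.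
Proof. exact: linearB. Qed.
Lemma homZ M N (f : hom M N) k : {morph f : x / k *: x}.
Proof. exact: linearZ. Qed.

Lemma monoP M N (f : hom M N) : mono f <-> lker f = 0%VS.
Proof.
split=> [mf | kf x fx0].
  by apply/eqP; rewrite -subv0; apply/subvP=> x; rewrite memv_ker memv0 => /eqP/mf->.
by apply/eqP; rewrite -memv0 -kf memv_ker fx0.
Qed.

Lemma mono_inj M N (f : hom M N) : mono f -> injective f.
Proof.
by move=> mf x y fxy; apply/eqP; rewrite -subr_eq0 (mf (x - y)) // linearB /= fxy subrr.
Qed.

Lemma epiP M N (f : hom M N) : epi f <-> limg f = fullv.
Proof.
split=> [ef | kf y].
  by apply/vspaceP=> y; case: (ef y) => x <-; rewrite memv_img ?memvf.
have /memv_imgP[x _ ->] : y \in limg f by rewrite kf memvf.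
by exists x.
Qed.

Lemma exactP M N Q (f : hom M N) (g : hom N Q) : exact f g <-> limg f = lker g.
Proof.
split=> [ex | e y].
  apply/vspaceP=> y; rewrite memv_ker; apply/memv_imgP/eqP => [[x _ ->]|/ex[x <-]].
    by apply/ex; exists x.
  by exists x; rewrite ?memvf.
split=> [g0|[x <-]].
  have /memv_imgP[x _ ->] : y \in limg f by rewrite e memv_ker g0.
  by exists x.
by apply/eqP; rewrite -memv_ker -e memv_img ?memvf.
Qed.

Lemma sesP M N Q (f : hom M N) (g : hom N Q) : ses f g <-> short_exact f g.
Proof.
split=> [[/monoP mf /epiP eg /exactP e]|[_ _ [mf e eg]]].
  by split; [exact: homP | exact: homP | split].
by split; [apply/monoP | apply/epiP | apply/exactP].
Qed.

Lemma hcomp_subproof M N Q (g : hom N Q) (f : hom M N) : is_hom (g \o f)%VF.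
Proof. by move=> a v; rewrite !lfun_valE !homA. Qed.
Definition hcomp M N Q (g : hom N Q) (f : hom M N) := MkHom (hcomp_subproof g f).
Lemma hcompE M N Q (g : hom N Q) (f : hom M N) x : hcomp g f x = g (f x).
Proof. exact: comp_lfunE. Qed.

Lemma hadd_subproof M N (f g : hom M N) : is_hom ((f : 'Hom(M, N)) + (g : 'Hom(M, N))).
Proof. by move=> a v; rewrite !lfun_valE !homA linearD. Qed.
Definition hadd M N (f g : hom M N) := MkHom (hadd_subproof f g).
Lemma haddE M N (f g : hom M N) x : hadd f g x = f x + g x.
Proof. exact: add_lfunE. Qed.

Lemma hscale_subproof M N (k : K) (f : hom M N) : is_hom (k *: (f : 'Hom(M, N))).
Proof. by move=> a v; rewrite !scale_lfunE homA linearZ. Qed.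
Definition hscale M N k (f : hom M N) := MkHom (hscale_subproof k f).
Lemma hscaleE M N k (f : hom M N) x : hscale k f x = k *: f x.
Proof. exact: scale_lfunE. Qed.

Definition hsub M N (f g : hom M N) := hadd f (hscale (-1) g).
Lemma hsubE M N (f g : hom M N) x : hsub f g x = f x - g x.
Proof. by rewrite haddE hscaleE scaleN1r. Qed.

Lemma hzero_subproof M N : is_hom (0 : 'Hom(M, N)).
Proof. by move=> a v; rewrite !zero_lfunE linear0. Qed.
Definition hzero M N := MkHom (@hzero_subproof M N).
Lemma hzeroE M N x : hzero M N x = 0.
Proof. exact: zero_lfunE. Qed.

Lemma hid_subproof M : is_hom (\1%VF : 'End(M)).
Proof. by move=> a v; rewrite !id_lfunE. Qed.
Definition hid M := MkHom (@hid_subproof M).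
Lemma hidE M x : hid M x = x.
Proof. exact: id_lfunE. Qed.

Lemma linfunE (V W : vectType K) (f : V -> W) (lf : linear f) x : linfun f x = f x.
Proof.
pose F := HB.pack_for {linear V -> W} f
  (GRing.isSemilinear.Build K V W _ f (GRing.semilinear_linear lf)).
exact: (lfunE F).
Qed.

Lemma hinl_linear M N : linear (fun x : M => (x, 0) : prodM M N).
Proof. by move=> k x y; rewrite [RHS]surjective_pairing /= scaler0 addr0. Qed.
Lemma hinr_linear M N : linear (fun x : N => (0, x) : prodM M N).
Proof. by move=> k x y; rewrite [RHS]surjective_pairing /= scaler0 addr0. Qed.

Lemma prodM_inj M N (a c : M) (b e : N) :
  (a, b) = (c, e) :> prodM M N -> a = c /\ b = e.
Proof. by case. Qed.

Lemma prodM_actE M N a (x : prodM M N) :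
  act (prodM M N) a x = (act M a x.1, act N a x.2).
Proof. by rewrite /= lfunE. Qed.

Lemma hinl_subproof M N :
  is_hom (linfun (fun x : M => (x, 0)) : 'Hom(M, prodM M N)).
Proof. by move=> a v; rewrite prodM_actE !(linfunE (@hinl_linear M N)) /= linear0. Qed.
Definition hinl M N : hom M (prodM M N) := MkHom (@hinl_subproof M N).
Lemma hinlE M N x : hinl M N x = (x, 0).
Proof. exact: (linfunE (@hinl_linear M N)). Qed.

Lemma hinr_subproof M N :
  is_hom (linfun (fun x : N => (0, x)) : 'Hom(N, prodM M N)).
Proof. by move=> a v; rewrite prodM_actE !(linfunE (@hinr_linear M N)) /= linear0. Qed.
Definition hinr M N : hom N (prodM M N) := MkHom (@hinr_subproof M N).
Lemma hinrE M N x : hinr M N x = (0, x).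
Proof. exact: (linfunE (@hinr_linear M N)). Qed.

Lemma hfst_subproof M N :
  is_hom (linfun (fst : (M * N)%type -> M) : 'Hom(prodM M N, M)).
Proof. by move=> a v; rewrite prodM_actE !lfunE. Qed.
Definition hfst M N : hom (prodM M N) M := MkHom (@hfst_subproof M N).
Lemma hfstE M N x : hfst M N x = x.1. Proof. by rewrite lfunE. Qed.

Lemma hsnd_subproof M N :
  is_hom (linfun (snd : (M * N)%type -> N) : 'Hom(prodM M N, N)).
Proof. by move=> a v; rewrite prodM_actE !lfunE. Qed.
Definition hsnd M N : hom (prodM M N) N := MkHom (@hsnd_subproof M N).
Lemma hsndE M N x : hsnd M N x = x.2. Proof. by rewrite lfunE. Qed.

Definition hcopair M N Q (f : hom M Q) (g : hom N Q) : hom (prodM M N) Q :=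
  hadd (hcomp f (hfst M N)) (hcomp g (hsnd M N)).
Lemma hcopairE M N Q (f : hom M Q) (g : hom N Q) x :
  hcopair f g x = f x.1 + g x.2.
Proof. by rewrite haddE !hcompE hfstE hsndE. Qed.

Definition hpair M N Q (f : hom Q M) (g : hom Q N) : hom Q (prodM M N) :=
  hadd (hcomp (hinl M N) f) (hcomp (hinr M N) g).
Lemma hpairE M N Q (f : hom Q M) (g : hom Q N) x : hpair f g x = (f x, g x).
Proof. by rewrite haddE !hcompE hinlE hinrE; congr pair; rewrite ?addr0 ?add0r. Qed.

Lemma hincl_subproof M (U : submod M) :
  is_hom (linfun vsval : 'Hom(subM U, M)).
Proof. by move=> a v; rewrite lfunE /= sub_actE lfunE. Qed.
Definition hincl M (U : submod M) : hom (subM U) M := MkHom (@hincl_subproof M U).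
Lemma hinclE M (U : submod M) x : hincl U x = vsval x. Proof. by rewrite lfunE. Qed.

Definition hquot M (U : submod M) : hom M (quotM U) := MkHom (@quot_proj_hom _ _ M U).

Lemma hquot_epi M (U : submod M) : epi (hquot U).
Proof. by apply/epiP; apply: limg_quot_pi. Qed.

Lemma hquot0 M (U : submod M) x : (hquot U x = 0) <-> x \in (U : {vspace M}).
Proof. by rewrite -(lker_quot_pi U) memv_ker; split => /eqP. Qed.

Lemma hincl_mono M (U : submod M) : mono (hincl U).
Proof. by move=> x; rewrite hinclE => e; apply: val_inj. Qed.

Lemma hincl_im M (U : submod M) y : (exists x, hincl U x = y) <-> y \in (U : {vspace M}).
Proof.
split=> [[x <-]|yU]; first by rewrite hinclE subvsP.
by exists (vsproj U y); rewrite hinclE vsprojK.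
Qed.

Lemma sub_ses M (U : submod M) : ses (hincl U) (hquot U).
Proof.
split; [exact: hincl_mono | exact: hquot_epi|] => y.
by rewrite hquot0 hincl_im.
Qed.

Definition kermod M N (f : hom M N) : submod M := kerS (homP f).

Lemma hker_ex M N (f : hom M N) :
  exact (hincl (kermod f)) f.
Proof. by move=> y; rewrite hincl_im memv_ker; split => /eqP. Qed.

Lemma img_stable M N (f : hom M N) a v : v \in limg f -> act N a v \in limg f.
Proof. by case/memv_imgP=> u _ ->; rewrite -homA memv_img ?memvf. Qed.
Definition immod M N (f : hom M N) : submod N := Submod (@img_stable M N f).
Lemma immodP M N (f : hom M N) y : y \in limg f <-> exists x, f x = y.
Proof. by split=> [/memv_imgP[x _ ->]|[x <-]]; [exists x | rewrite memv_img ?memvf]. Qed.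

Lemma coker_ex M N (f : hom M N) :
  epi (hquot (immod f)) /\ exact f (hquot (immod f)).
Proof.
split; first exact: hquot_epi.
by move=> y; rewrite hquot0 -immodP.
Qed.

(** A linear section of s need not be A-linear, but its composite with f is, since f kills ker s. *)
Lemma factor_epi X Y N (s : hom X Y) (f : hom X N) :
  epi s -> (forall x, s x = 0 -> f x = 0) ->
  exists g : hom Y N, forall x, g (s x) = f x.
Proof.
move=> /epiP es sf.
have sK y : s (s^-1%VF y) = y by rewrite limg_lfunVK // es memvf.
have key x y : s x = y -> f (s^-1%VF y) = f x.
  by move=> sxy; apply/eqP; rewrite -subr_eq0 -linearB /= sf // linearB /= sK sxy subrr.
have hg : is_hom (f \o s^-1)%VF.
  by move=> a v; rewrite !lfun_valE -homA; apply: key; rewrite homA sK.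
by exists (MkHom hg) => x /=; rewrite lfun_valE (key x).
Qed.

Lemma factor_mono X Y M (i : hom X Y) (f : hom M Y) :
  mono i -> (forall m, exists x, i x = f m) ->
  exists g : hom M X, forall m, i (g m) = f m.
Proof.
move=> mi fi.
have key m : i (i^-1%VF (f m)) = f m.
  by rewrite limg_lfunVK //; case: (fi m) => x <-; rewrite memv_img ?memvf.
have hg : is_hom (i^-1 \o f)%VF.
  by move=> a v; apply: (mono_inj mi); rewrite homA !lfun_valE !key homA.
by exists (MkHom hg) => m; rewrite lfun_valE key.
Qed.

Lemma hiso_inv M N (f : hom M N) : mono f -> epi f ->
  exists g : hom N M, (forall x, g (f x) = x) /\ (forall y, f (g y) = y).
Proof.
move=> mf ef.
have [g gf] : exists g : hom N M, forall x, g (f x) = hid M x.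
  by apply: (factor_epi ef) => x /mf ->; rewrite linear0.
exists g; split=> x; first by rewrite gf hidE.
by case: (ef x) => y <-; rewrite gf hidE.
Qed.

Definition hiso M N := exists (f : hom M N) (g : hom N M),
  (forall x, g (f x) = x) /\ (forall y, f (g y) = y).

Lemma can_mono M N (f : hom M N) (g : hom N M) : (forall x, g (f x) = x) -> mono f.
Proof. by move=> gf x fx0; rewrite -(gf x) fx0 linear0. Qed.

Lemma hisoP M N : iso M N <-> hiso M N.
Proof.
split=> [[f [hf kf ef]]|[f [g [fg gf]]]].
  have mf := proj2 (monoP (MkHom hf)) kf; have sf := proj2 (epiP (MkHom hf)) ef.
  by have [g gP] := hiso_inv mf sf; exists (MkHom hf), g.
exists f; split; first exact: homP.
  by apply/monoP; apply: can_mono fg.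
by apply/epiP => y; exists (g y).
Qed.

Lemma hiso_sym M N : hiso M N -> hiso N M.
Proof. by move=> [f [g [fg gf]]]; exists g, f. Qed.

Lemma ses_dim M N Q (f : hom M N) (g : hom N Q) : ses f g ->
  (\dim {:N} = \dim {:M} + \dim {:Q})%N.
Proof.
move=> /sesP[_ _ [kf e eg]].
rewrite -(limg_ker_dim g fullv) capfv eg -e; congr addn.
by rewrite limg_dim_eq // kf capv0.
Qed.

Lemma dim0_eq0 M (x : M) : \dim {:M} = 0%N -> x = 0.
Proof. by move=> /eqP; rewrite dimv_eq0 => /eqP e; apply/eqP; rewrite -memv0 -e memvf. Qed.

Lemma dim_gt0 M (x : M) : x <> 0 -> (0 < \dim {:M})%N.
Proof. by move=> x0; rewrite lt0n; apply/eqP => /(dim0_eq0 x). Qed.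

Lemma reg_hom M (m : M) : exists f : hom (regM A) M, forall a : A, f a = act M a m.
Proof.
have lf : linear (fun a : regM A => act M a m).
  by move=> k a b; rewrite linearP !lfun_valE.
have hf : is_hom (linfun (fun a : regM A => act M a m) : 'Hom(regM A, M)).
  by move=> a b; rewrite !(linfunE lf) lfunE /= actM lfun_valE.
by exists (MkHom hf) => a; rewrite /= (linfunE lf).
Qed.

Lemma eval_linear M N (x : M) : linear (fun f : 'Hom(M, N) => f x).
Proof. by move=> k f g; rewrite !lfun_valE. Qed.

(** A subspace of N, so that its dimension can serve as an induction measure. *)
Definition homs_at M N (x : M) : {vspace N} :=
  (linfun (fun f : 'Hom(M, N) => f x) @: homspace M N)%VS.

Lemma homs_atP M N (x : M) y : y \in homs_at N x <-> exists f : hom M N, f x = y.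
Proof.
split=> [/memv_imgP[f /homspaceP hf ->]|[f <-]].
  by exists (MkHom hf); rewrite (linfunE (eval_linear x)).
rewrite -(linfunE (eval_linear x)); apply: memv_img; apply/homspaceP; exact: homP.
Qed.

End Homs.

Opaque hcomp hadd hscale hsub hzero hid hinl hinr hfst hsnd hcopair hpair hincl hquot.

(** * Vanishing of Ext^1 and filtrations *)

Section Ext.
Variables (K : fieldType) (A : falgType K).
Implicit Types (M N P Q X Y Z : fdmod A).

Lemma proj_lift P M N (g : hom M N) (f : hom P N) : projective P -> epi g ->
  exists h : hom P M, forall x, g (h x) = f x.
Proof.
move=> pP /epiP eg; have [h hh e] := pP _ _ _ _ (homP g) eg (homP f).
by exists (MkHom hh) => x /=; rewrite -e lfun_valE.
Qed.

Lemma reg_projective : projective (regM A).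
Proof.
move=> M N g f hg eg hf.
have [m gm] := proj2 (epiP (MkHom hg)) eg (f (1 : A)).
have [h hE] := reg_hom m.
exists h; first exact: homP.
apply/lfunP=> a; rewrite lfun_valE hE hg; rewrite /= in gm; rewrite gm -hf.
by rewrite /= lfunE /= mulr1.
Qed.

Lemma prod_projective P Q : projective P -> projective Q -> projective (prodM P Q).
Proof.
move=> pP pQ M N g f hg eg hf.
have eg' : epi (MkHom hg) by apply/epiP.
have [h1 e1] := proj_lift (hcomp (MkHom hf) (hinl P Q)) pP eg'.
have [h2 e2] := proj_lift (hcomp (MkHom hf) (hinr P Q)) pQ eg'.
exists (hcopair h1 h2); first exact: homP.
apply/lfunP=> x; rewrite lfun_valE hcopairE linearD /=.
move: (e1 x.1) (e2 x.2) => /= -> ->.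
rewrite !lfun_valE -linearD /= hinlE hinrE; congr (f _).
by case: x => x y; congr pair; rewrite ?addr0 ?add0r.
Qed.

Lemma epi_of_span M N (f : hom M N) (s : seq N) :
  <<s>>%VS = fullv -> (forall v, v \in s -> exists x, f x = v) -> epi f.
Proof.
move=> sN h; apply/epiP/eqP; rewrite eqEsubv subvf -sN.
by apply/span_subvP => v /h /immodP.
Qed.

(** Free on a basis of M: enough projectives, with no minimality claimed. *)
Lemma proj_cover_ex M : exists (Q : fdmod A) (q : hom Q M), projective Q /\ epi q.
Proof.
suff [Q [q [pQ h]]] : exists (Q : fdmod A) (q : hom Q M), projective Q /\
    forall v, v \in (vbasis {:M} : seq M) -> exists x, q x = v.
  exists Q, q; split=> //; apply: epi_of_span h.
  by rewrite (span_basis (vbasisP _)).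
elim: (vbasis {:M} : seq M) => [|v s [Q [q [pQ h]]]].
  by exists (regM A), (hzero _ _); split=> //; apply: reg_projective.
have [f fE] := reg_hom v.
exists (prodM (regM A) Q), (hcopair f q); split.
  by apply: prod_projective => //; apply: reg_projective.
move=> w; rewrite inE => /orP[/eqP->|/h[x <-]].
  by exists (1 : A, 0); rewrite hcopairE fE hom0 addr0 act1 lfun_valE.
by exists (0, x); rewrite hcopairE hom0 add0r.
Qed.

(* Ext^1(M, N) = 0. *)
Definition ext0 M N := forall X Y (i : hom X Y) (p : hom Y M), ses i p ->
  forall f : hom X N, exists g : hom Y N, forall x, g (i x) = f x.

(** Ext^1(M, N) is the cokernel of Hom(Q, N) -> Hom(Z, N). An extension Y of M by X is the quotient
    of X + Q by a copy of Z, embedded as (-r, k); the pair (f, t) with t k = f r kills it. *)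
Lemma ext0_pres M N Z Q (k : hom Z Q) (q : hom Q M) : projective Q -> ses k q ->
  (forall f : hom Z N, exists g : hom Q N, forall z, g (k z) = f z) -> ext0 M N.
Proof.
move=> pQ [mk eq exk] H X Y i p [mi ep exi] f.
have [l lE] := proj_lift q pQ ep.
have [r rE] : exists r : hom Z X, forall z, i (r z) = hcomp l k z.
  apply: factor_mono => // z; apply/exi.
  by rewrite hcompE lE; apply/exk; exists z.
have [t tE] := H (hcomp f r).
have [g gE] : exists g : hom Y N, forall x, g (hcopair i l x) = hcopair f t x.
  apply: factor_epi => [y|[x z]].
    have [z qz] := eq (p y).
    have [x ix] : exists x, i x = y - l z.
      by apply/exi; rewrite homB lE qz subrr.
    by exists (x, z); rewrite hcopairE /= ix subrK.
  rewrite !hcopairE /= => e0.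
  have /exk[z' kz] : q z = 0.
    have := congr1 p e0; rewrite homD hom0 lE.
    by have -> : p (i x) = 0; [apply/exi; exists x | rewrite add0r].
  move: e0; rewrite -kz tE hcompE -(hcompE l k) -rE -homD => /mi.
  by rewrite -homD => ->; rewrite hom0.
exists g => x; have := gE (x, 0).
by rewrite !hcopairE /= !hom0 !addr0.
Qed.

(** A lift l : Q -> Y of f q maps ker q into N; this restriction extends to Q by hypothesis, and
    subtracting the extension from l gives a map on M. *)
Lemma ext0_lift M N Y X (i : hom N Y) (p : hom Y X) (f : hom M X) :
  ext0 M N -> ses i p -> exists g : hom M Y, forall m, p (g m) = f m.
Proof.
move=> eMN [mi ep exi].
have [Q [q [pQ eq]]] := proj_cover_ex M.
have [l lE] := proj_lift (hcomp f q) pQ ep.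
pose k := hincl (kermod q).
have sk : ses k q by split; [exact: hincl_mono | | exact: hker_ex].
have [r rE] : exists r : hom (subM (kermod q)) N, forall z, i (r z) = hcomp l k z.
  apply: factor_mono => // z; apply/exi; rewrite hcompE lE hcompE.
  have -> : q (k z) = 0 by apply/(hker_ex q); exists z.
  exact: hom0.
have [t tE] := eMN _ _ _ _ sk r.
have [g gE] : exists g : hom M Y, forall x, g (q x) = hsub l (hcomp i t) x.
  apply: factor_epi => // x /(hker_ex q)[z <-].
  by rewrite hsubE !hcompE tE rE hcompE subrr.
exists g => m; case: (eq m) => x <-; rewrite gE hsubE homB lE !hcompE.
by have -> : p (i (t x)) = 0; [apply/exi; exists (t x) | rewrite subr0].
Qed.

Lemma ses_iso_r M N Q Q' (f : hom M N) (g : hom N Q) (h : hom Q Q') :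
  ses f g -> mono h -> epi h -> ses f (hcomp h g).
Proof.
move=> [mf eg ex] mh eh; split=> // [y|y].
  by have [x <-] := eh y; have [z <-] := eg x; exists z; rewrite hcompE.
rewrite -ex hcompE; split=> [/mh //|->]; exact: hom0.
Qed.

Lemma ext0_isol M M' N : hiso M M' -> ext0 M N -> ext0 M' N.
Proof.
move=> [f [g [fg gf]]] e X Y i p s; apply: (e _ _ _ (hcomp g p)).
apply: ses_iso_r => //; first exact: can_mono gf.
by move=> y; exists (f y).
Qed.

Lemma ext0_isor M N N' : hiso N N' -> ext0 M N -> ext0 M N'.
Proof.
move=> [u [v [vu uv]]] e X Y i p s f.
have [g gE] := e _ _ _ _ s (hcomp v f).
by exists (hcomp u g) => x; rewrite hcompE gE hcompE uv.
Qed.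

(** V is the preimage of N1 in M, the kernel of M -> N2. *)
Lemma ses_pull M1 M M2 N1 N2 (a : hom M1 M) (b : hom M M2) (a' : hom N1 M2)
    (b' : hom M2 N2) : ses a b -> ses a' b' ->
  exists (V : fdmod A) (j : hom V M) (i : hom M1 V) (r : hom V N1),
    [/\ ses j (hcomp b' b), ses i r, forall x, j (i x) = a x
      & forall x, a' (r x) = b (j x)].
Proof.
move=> [ma eb exa] [ma' eb' exa'].
pose c := hcomp b' b; pose j := hincl (kermod c).
have mj : mono j by exact: hincl_mono.
have sj : ses j c.
  split; [exact: mj | | exact: hker_ex] => y.
  by have [m <-] := eb' y; have [x <-] := eb m; exists x; rewrite hcompE.
have cj z : b' (b (j z)) = 0 by rewrite -hcompE; apply/(hker_ex c); exists z.
have ba x : b (a x) = 0 by apply/exa; exists x.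
have [i iE] : exists i : hom M1 (subM (kermod c)), forall x, j (i x) = a x.
  by apply: factor_mono => // x; apply/(hker_ex c); rewrite hcompE ba hom0.
have [r rE] : exists r : hom (subM (kermod c)) N1, forall z, a' (r z) = hcomp b j z.
  by apply: factor_mono => // z; apply/exa'; rewrite hcompE cj.
exists (subM (kermod c)), j, i, r; split=> // [|x]; last by rewrite rE hcompE.
split=> [x i0|m|z].
- by apply: ma; rewrite -iE i0 hom0.
- have [y py] := eb (a' m).
  have [z jz] : exists z, j z = y.
    by apply/(hker_ex c); rewrite hcompE py; apply/exa'; exists m.
  by exists z; apply: (mono_inj ma'); rewrite rE hcompE jz.
split=> [r0|[x <-]].
  have /exa[x ax] : b (j z) = 0 by rewrite -hcompE -rE r0 hom0.
  by exists x; apply: (mono_inj mj); rewrite -ax iE.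
by apply: ma'; rewrite rE hcompE iE ba.
Qed.

Lemma ses_comp M M1 M2 C C' (i : hom M M1) (p : hom M1 C) (i' : hom M1 M2)
    (p' : hom M2 C') : ses i p -> ses i' p' ->
  exists (C2 : fdmod A) (q : hom M2 C2) (u : hom C C2) (v : hom C2 C'),
    ses (hcomp i' i) q /\ ses u v.
Proof.
move=> [mi ep exi] [mi' ep' exi'].
pose c := hcomp i' i; pose q := hquot (immod c).
have [eq exq] : epi q /\ exact c q by exact: coker_ex.
have [u uE] : exists u : hom C (quotM (immod c)), forall y, u (p y) = hcomp q i' y.
  apply: factor_epi => // y /exi[m <-]; rewrite hcompE; apply/exq.
  by exists m; rewrite hcompE.
have [v vE] : exists v : hom (quotM (immod c)) C', forall z, v (q z) = p' z.
  apply: factor_epi => // z /exq[m <-]; rewrite hcompE; apply/exi'.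
  by exists (i m).
exists (quotM (immod c)), q, u, v; split; split=> //.
- by move=> x; rewrite hcompE => /mi' /mi.
- move=> x; have [y <-] := ep x; rewrite uE hcompE => /exq[m].
  by rewrite hcompE => /(mono_inj mi') <-; apply/exi; exists m.
- by move=> y; have [z <-] := ep' y; exists (q z).
move=> w; have [z <-] := eq w; rewrite vE; split=> [/exi'[y <-]|[y]].
  by exists (p y); rewrite uE hcompE.
have [x <-] := ep y; rewrite uE hcompE -vE => <-; rewrite vE.
by apply/exi'; exists x.
Qed.

Lemma ext0_extl M1 M M2 N (a : hom M1 M) (b : hom M M2) :
  ses a b -> ext0 M1 N -> ext0 M2 N -> ext0 M N.
Proof.
move=> s e1 e2 X Y i p s' f.
have [V [j [i' [r [sj si ji _]]]]] := ses_pull s' s.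
have [g gE] := e1 _ _ _ _ si f.
have [h hE] := e2 _ _ _ _ sj g.
by exists h => x; rewrite -gE -hE ji.
Qed.

Lemma ext0_extr M N1 N N2 (a : hom N1 N) (b : hom N N2) :
  ses a b -> ext0 M N1 -> ext0 M N2 -> ext0 M N.
Proof.
move=> [ma eb exa] e1 e2.
have [Q [q [pQ eq]]] := proj_cover_ex M.
pose k := hincl (kermod q).
have sk : ses k q by split; [exact: hincl_mono | | exact: hker_ex].
apply: (ext0_pres pQ sk) => f.
have [t tE] := e2 _ _ _ _ sk (hcomp b f).
have [t' t'E] := proj_lift t pQ eb.
have [r rE] : exists r : hom (subM (kermod q)) N1, forall z,
    a (r z) = hsub f (hcomp t' k) z.
  apply: factor_mono => // z; apply/exa.
  by rewrite hsubE homB hcompE t'E tE hcompE subrr.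
have [s sE] := e1 _ _ _ _ sk r.
exists (hadd t' (hcomp a s)) => z.
by rewrite haddE hcompE sE rE hsubE hcompE addrC subrK.
Qed.

(* The end of the long exact sequence
   Hom(M, N) -> Hom(M1, N) -> Ext^1(M2, N) -> Ext^1(M, N). *)
Lemma ext0_quot M1 M M2 N (a : hom M1 M) (b : hom M M2) : ses a b -> ext0 M N ->
  (forall f : hom M1 N, exists g : hom M N, forall x, g (a x) = f x) -> ext0 M2 N.
Proof.
move=> [ma eb exa] e H.
have [Q [q [pQ eq]]] := proj_cover_ex M.
pose c := hcomp b q; pose k := hincl (kermod c).
have sk : ses k c.
  split; [exact: hincl_mono | | exact: hker_ex] => y.
  by have [m <-] := eb y; have [x <-] := eq m; exists x; rewrite hcompE.
apply: (ext0_pres pQ sk) => f.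
have [r rE] : exists r : hom (subM (kermod c)) M1, forall z, a (r z) = hcomp q k z.
  apply: factor_mono => // z; apply/exa; rewrite hcompE -(hcompE b q).
  by apply/(hker_ex c); exists z.
pose j := hincl (kermod q).
have sj : ses j q by split; [exact: hincl_mono | | exact: hker_ex].
have qj z : q (j z) = 0 by apply/(hker_ex q); exists z.
have [j' jE] : exists j' : hom (subM (kermod q)) (subM (kermod c)),
    forall z, k (j' z) = j z.
  apply: factor_mono; first exact: hincl_mono.
  by move=> z; apply/(hker_ex c); rewrite hcompE qj hom0.
have [t tE] := e _ _ _ _ sj (hcomp f j').
have [u uE] : exists u : hom M1 N, forall z, u (r z) = hsub f (hcomp t k) z.
  apply: factor_epi => [m|z r0].
    have [x qx] := eq (a m).
    have [z kz] : exists z, k z = x.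
      by apply/(hker_ex c); rewrite hcompE qx; apply/exa; exists m.
    by exists z; apply: (mono_inj ma); rewrite rE hcompE kz.
  have /(hker_ex q)[y jy] : q (k z) = 0 by rewrite -hcompE -rE r0 hom0.
  have -> : z = j' y by apply: (mono_inj (@hincl_mono _ _ _ (kermod c))); rewrite jE jy.
  by rewrite hsubE hcompE jE tE hcompE subrr.
have [v vE] := H u.
exists (hadd t (hcomp v q)) => z.
by rewrite haddE hcompE -(hcompE q k) -rE vE uE hsubE hcompE addrC subrK.
Qed.

Lemma prod_ses M N : ses (hinl M N) (hsnd M N).
Proof.
split=> [x|y|[x y]]; rewrite ?hsndE /=.
- by rewrite hinlE => /(congr1 fst).
- by exists (0, y); rewrite hsndE.
by split=> [->|[z]]; [exists x; rewrite hinlE | rewrite hinlE => -[_ <-]].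
Qed.

Lemma ext0_prodl M M' N : ext0 M N -> ext0 M' N -> ext0 (prodM M M') N.
Proof. exact: ext0_extl (prod_ses M M'). Qed.

Lemma ext0_prodr M N N' : ext0 M N -> ext0 M N' -> ext0 M (prodM N N').
Proof. exact: ext0_extr (prod_ses N N'). Qed.

Lemma ext0_0 M N : (forall m : M, m = 0) -> ext0 M N.
Proof.
move=> M0 X Y i p [mi ep exi] f.
have [g gE] : exists g : hom Y X, forall y, i (g y) = hid Y y.
  by apply: factor_mono => // y; apply/exi; apply: M0.
exists (hcomp f g) => x; rewrite hcompE; suff -> : g (i x) = x by [].
by apply: (mono_inj mi); rewrite gE hidE.
Qed.

(* P is projective with P/V = S; the kernel of M -> S is then computed by
   presenting M as a quotient of Y + P. *)
Lemma ext0_ker M1 M S N P V (a : hom M1 M) (b : hom M S) (k : hom V P)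
    (pi : hom P S) : projective P -> ses k pi -> ses a b ->
  ext0 M N -> ext0 V N -> ext0 M1 N.
Proof.
move=> pP [mk epi exk] [ma eb exa] eM eV X Y i p [mi ep exi] f.
have [l lE] := proj_lift pi pP eb.
pose q := hcopair (hcomp a p) l; pose j := hincl (kermod q).
have qE x y : q (x, y) = a (p x) + l y by rewrite hcopairE hcompE.
have sj : ses j q.
  split; [exact: hincl_mono | | exact: hker_ex] => m.
  have [y piy] := epi (b m).
  have [m1 am] : exists m1, a m1 = m - l y.
    by apply/exa; rewrite homB lE piy subrr.
  by have [x px] := ep m1; exists (x, y); rewrite qE px am subrK.
have qj z : q (j z) = 0 by apply/(hker_ex q); exists z.
have [s sE] : exists s : hom (subM (kermod q)) V, forall z,
    k (s z) = hcomp (hsnd Y P) j z.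
  apply: factor_mono => // z; apply/exk; rewrite hcompE hsndE.
  have := congr1 b (qj z); rewrite [j z]surjective_pairing qE homD hom0 lE.
  have -> : b (a (p (j z).1)) = 0 by apply/exa; exists (p (j z).1).
  by rewrite add0r.
have [i' iE] : exists i' : hom X (subM (kermod q)), forall x,
    j (i' x) = hcomp (hinl Y P) i x.
  apply: factor_mono => [|x]; first exact: hincl_mono.
  apply/(hker_ex q); rewrite hcompE hinlE qE [l _]hom0 addr0.
  have -> : p (i x) = 0 by apply/exi; exists x.
  exact: hom0.
(* The kernel of q lies in two sequences: X -> ker q -> V, where [eV] applies, and ker q -> Y + P ->
   M, where [eM] applies. *)
have ss : ses i' s.
  split=> [x i0|v|z].
  - have := iE x; rewrite i0 hom0 hcompE hinlE => -[/esym]; exact: mi.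
  - have [m1 am] : exists m1, a m1 = - l (k v).
      by apply/exa; rewrite homN lE; apply/eqP; rewrite oppr_eq0; apply/eqP/exk; exists v.
    have [x px] := ep m1.
    have [z jz] : exists z, j z = (x, k v).
      by apply/(hker_ex q); rewrite qE px am addNr.
    by exists z; apply: (mono_inj mk); rewrite sE hcompE hsndE jz.
  split=> [s0|[x <-]].
    have z2 : (j z).2 = 0 by rewrite -hsndE -hcompE -sE s0 hom0.
    have := qj z; rewrite [j z]surjective_pairing qE z2 hom0 addr0 => /ma.
    move=> /exi[x ix]; exists x; apply: (mono_inj (@hincl_mono _ _ _ (kermod q))).
    by rewrite iE hcompE hinlE ix -z2 -surjective_pairing.
  by apply: mk; rewrite sE hcompE iE hcompE hinlE hsndE.
have [g gE] := eV _ _ _ _ ss f.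
have [h hE] := eM _ _ _ _ sj g.
exists (hcomp h (hinl Y P)) => x.
by rewrite -gE -hE iE !hcompE.
Qed.

Section Fil.
Variable S : fdmod A -> Prop.

(** Closure under isomorphism and extension. Unlike [filtration] it records no list of layers, and
    inductions treat submodule and quotient alike. *)
Inductive fil : fdmod A -> Prop :=
| fil_zero M : (forall m : M, m = 0) -> fil M
| fil_std M M' : S M -> hiso M M' -> fil M'
| fil_ext M1 M M2 (a : hom M1 M) (b : hom M M2) :
    ses a b -> fil M1 -> fil M2 -> fil M.

Lemma fil_ext0 N : (forall M, S M -> ext0 M N) -> forall M, fil M -> ext0 M N.
Proof.
move=> H M; elim=> {M} [M /ext0_0 //|M M' /H e /ext0_isol|M1 M M2 a b s _ e1 _ e2].
  by apply.
exact: ext0_extl s e1 e2.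
Qed.

Lemma fil_ext0_r N : (forall M, S M -> ext0 N M) -> forall M, fil M -> ext0 N M.
Proof.
move=> H M; elim=> {M} [M M0|M M' /H e /ext0_isor|M1 M M2 a b s _ e1 _ e2].
- by move=> X Y i p _ f; exists (hzero Y M) => x; rewrite hzeroE [RHS]M0.
- by apply.
exact: ext0_extr s e1 e2.
Qed.

Lemma fil_hom0 N : (forall M, S M -> forall f : hom M N, forall x, f x = 0) ->
  forall M, fil M -> forall f : hom M N, forall x, f x = 0.
Proof.
move=> H M; elim=> {M}
  [M M0 f x|M M' /H e [u [v [vu uv]]] f x|M1 M M2 a b s _ e1 _ e2 f].
- by rewrite (M0 x) hom0.
- by rewrite -(uv x) -hcompE e.
case: s => ma eb ex.
have [g gE] : exists g : hom M2 N, forall x, g (b x) = f x.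
  by apply: factor_epi => // x /ex [y <-]; rewrite -hcompE e1.
by move=> x; rewrite -gE e2.
Qed.

End Fil.

Lemma fil_sub (S S' : fdmod A -> Prop) M :
  (forall M, S M -> S' M) -> fil S M -> fil S' M.
Proof.
move=> H; elim=> {M} [M M0|M M' /H e i|M1 M M2 a b s _ e1 _ e2].
- exact: fil_zero.
- exact: fil_std e i.
exact: fil_ext s e1 e2.
Qed.

Lemma filtration_fil (I : Type) (X : I -> fdmod A) (S : pred I) M s :
  filtration X M s -> all S s -> fil (fun N => exists2 i, S i & N = X i) M.
Proof.
move=> h; elim: h => {M s} [M M0 _|M U i s iX _ IH /= /andP[Si /IH fU]].
  by apply: fil_zero => m; apply: dim0_eq0; rewrite M0 dimv0.
apply: (fil_ext (sub_ses U) fU); apply: (@fil_std _ (X i)); first by exists i.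
by apply: hiso_sym; apply/hisoP.
Qed.

End Ext.

(** * Finite powers of a module and embeddings into them *)

Section Powers.
Variables (K : fieldType) (A : falgType K).
Implicit Types (M N X Z : fdmod A).

Fixpoint htuple X Z (fs : seq (hom X Z)) : hom X (dsum (nseq (size fs) Z)) :=
  if fs is f :: fs' then hpair f (htuple fs') else hzero X (zeroM A).

Lemma htuple_proj X Z (fs : seq (hom X Z)) i : (i < size fs)%N ->
  exists p : hom (dsum (nseq (size fs) Z)) Z,
    forall x, p (htuple fs x) = nth (hzero X Z) fs i x.
Proof.
have E f fs' (x : X) : htuple (f :: fs') x = (f x, htuple fs' x) by exact: hpairE.
elim: fs i => // f fs IH [_|i /IH[p pE]].
  by exists (hfst Z (dsum (nseq (size fs) Z))) => x; rewrite E hfstE.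
exists (hcomp p (hsnd Z (dsum (nseq (size fs) Z)))) => x.
by rewrite E hcompE hsndE pE.
Qed.

Lemma in_add_power Z n : in_add Z (dsum (nseq n Z)).
Proof.
exists n, (zeroM A); apply/hisoP; exists (hfst _ _), (hinl _ _); split=> x.
  rewrite hfstE hinlE [RHS]surjective_pairing; congr pair.
  by apply/rowP; case.
by rewrite hfstE hinlE.
Qed.

(** A plain function: a map commuting with End(Z) need not be A-linear. *)
Fixpoint power_map Z (a : Z -> Z) n : dsum (nseq n Z) -> dsum (nseq n Z) :=
  if n is n'.+1 then fun x : Z * dsum (nseq n' Z) => (a x.1, power_map a x.2)
  else id.

Lemma power_map_comm Z (a : 'End(Z)) : (forall (f : hom Z Z) x, f (a x) = a (f x)) ->
  forall n (g : hom (dsum (nseq n Z)) Z) x, g (power_map a x) = a (g x).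
Proof.
move=> ha; elim=> [|n IH] g x.
  by have -> : x = 0; [apply/rowP; case | rewrite hom0 linear0].
have dec (y : prodM Z (dsum (nseq n Z))) : y = hinl _ _ y.1 + hinr _ _ y.2.
  by rewrite hinlE hinrE; case: y => b c; congr pair; rewrite ?addr0 ?add0r.
rewrite [power_map a x](dec (a x.1, power_map a x.2)) [in RHS](dec x).
rewrite (homD g) (homD g) -!hcompE ha IH.
by rewrite !hcompE linearD.
Qed.

Lemma hom_list M N (s : seq 'Hom(M, N)) : (forall f, f \in s -> is_hom f) ->
  exists fs : seq (hom M N), map (@hom_fun _ _ M N) fs = s.
Proof.
elim: s => [|f s IH] h; first by exists [::].
have [fs <-] := IH (fun g gs => h g (mem_behead (s := f :: s) gs)).
by exists (MkHom (h f (mem_head _ _)) :: fs).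
Qed.

Lemma cogen_list M N :
  exists fs : seq (hom M N), forall x,
    (forall i, (i < size fs)%N -> nth (hzero M N) fs i x = 0) ->
    forall f : hom M N, f x = 0.
Proof.
have [|fs fsE] := @hom_list M N (vbasis (homspace M N)).
  by move=> f /vbasis_mem /homspaceP.
exists fs => x h f; have /homspaceP/coord_vbasis -> := homP f.
rewrite sum_lfunE big1 // => i _; rewrite scale_lfunE.
have szE : size fs = \dim (homspace M N).
  by rewrite -(size_map (@hom_fun _ _ M N)) fsE size_tuple.
rewrite -fsE (nth_map (hzero M N)) ?szE // h ?szE ?scaler0 //.
Qed.

End Powers.

(** * Duality, weights and standard modules *)

Section HighestWeightDuality.
Variables (K : fieldType) (A : falgType K) (D : contrafunctor A).
Implicit Types (M N Q X Y Z : fdmod A).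
Hypothesis exD : exact_functor D.
Hypothesis eqD : equivalence D.
Variable eta : forall M, hom M (D (D M)).
Hypothesis eta_mono : forall M, mono (eta M).
Hypothesis eta_epi : forall M, epi (eta M).

Definition Dm M N (f : hom M N) : hom (D N) (D M) :=
  MkHom (@fmap_hom K A D M N f (homP f)).

Lemma DmE M N (f : hom M N) : hom_fun (Dm f) = fmap D f. Proof. by []. Qed.

Hypothesis eta_nat : forall M N (f : hom M N) x, eta N (f x) = Dm (Dm f) (eta M x).

Lemma Dm_comp M N Q (f : hom M N) (g : hom N Q) y :
  Dm (hcomp g f) y = Dm f (Dm g y).
Proof.
rewrite !DmE; have -> : hom_fun (hcomp g f) = (g \o f)%VF.
  by [].
by rewrite (fmap_comp D (homP f) (homP g)) lfun_valE.
Qed.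

Lemma Dm_0 M N (f : hom M N) : (forall x, f x = 0) -> forall y, Dm f y = 0.
Proof.
move=> f0 y; have e : hom_fun f = 0 by apply/lfunP => x; rewrite f0 lfun_valE.
rewrite !DmE e; have h0 := @hzero_subproof _ _ M N.
have := proj1 exD M N _ _ h0 h0; rewrite addr0 => /lfunP/(_ y).
rewrite lfun_valE => /eqP; rewrite -{1}[fmap D 0 y]addr0 (inj_eq (addrI _)).
by move=> /eqP <-.
Qed.

Lemma Dm_faith M N (f g : hom M N) : (forall y, Dm f y = Dm g y) ->
  forall x, f x = g x.
Proof.
case: eqD => faith _ _ h x; suff -> : hom_fun f = hom_fun g by [].
by apply: faith; [exact: homP | exact: homP | apply/lfunP].
Qed.

Lemma Dm_faith0 M N (f : hom M N) : (forall y, Dm f y = 0) -> forall x, f x = 0.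
Proof.
move=> h x; rewrite -(@hzeroE _ _ M N x); apply: Dm_faith => y.
by rewrite h (Dm_0 (@hzeroE _ _ M N)).
Qed.

Lemma Dm_full M N (h : hom (D N) (D M)) : exists f : hom M N, forall y, Dm f y = h y.
Proof.
case: eqD => _ /(_ _ _ _ (homP h)) [f hf e] _.
by exists (MkHom hf) => y /=; rewrite e.
Qed.

Lemma Dm_ses M N Q (f : hom M N) (g : hom N Q) : ses f g -> ses (Dm g) (Dm f).
Proof. by move=> /sesP h; apply/sesP; exact: (proj2 exD _ _ _ _ _ h). Qed.

Lemma Dm_epi M N (f : hom M N) : mono f -> epi (Dm f).
Proof.
move=> mf; have [eq ex] := coker_ex f.
by have [] := Dm_ses (And3 mf eq ex).
Qed.

Lemma Dm_mono M N (f : hom M N) : epi f -> mono (Dm f).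
Proof.
move=> ef; have s := And3 (@hincl_mono _ _ _ (kermod f)) ef (hker_ex f).
by have [] := Dm_ses s.
Qed.

Lemma iso_DD M : hiso M (D (D M)).
Proof. by have [g [h1 h2]] := hiso_inv (@eta_mono M) (@eta_epi M); exists (eta M), g. Qed.

(** Reversing arrows turns the extension problem into the lifting problem of [ext0_lift]; fullness
    of D brings the lift back. *)
Lemma ext0_D M N : ext0 M N -> ext0 (D N) (D M).
Proof.
move=> e X Y i p s f.
have e' : ext0 (D (D M)) (D (D N)).
  by apply: ext0_isol (iso_DD M) _; apply: ext0_isor (iso_DD N) _.
have [l lE] := ext0_lift (Dm f) e' (Dm_ses s).
have [g gE] := Dm_full l.
exists g => x; rewrite -hcompE; apply: Dm_faith => y.
by rewrite Dm_comp gE lE.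
Qed.

Lemma ext0_DD M N : ext0 (D N) (D M) -> ext0 M N.
Proof.
move=> /ext0_D e; apply: ext0_isol (hiso_sym (iso_DD M)) _.
by apply: ext0_isor (hiso_sym (iso_DD N)) _.
Qed.

Variables (d : Order.disp_t) (Lam : finPOrderType d) (L P : Lam -> fdmod A).
Variable eps : forall l, 'Hom(P l, L l).
Implicit Types k l m : Lam.
Hypothesis simplesL : complete_simples L.
Hypothesis splitL : forall l, End_is_scalar (L l).
Hypothesis coverP : forall l, projective_cover (eps l).
Hypothesis qhP : quasi_hereditary eps.
Hypothesis simpleD : forall S : fdmod A, simple S -> iso (D S) S.

Lemma max_elem (S : pred Lam) i : S i ->
  exists2 j, S j & forall k, S k -> ~~ (j < k)%O.
Proof.
move=> Si; pose F (j : Lam) := #|[pred x | (x <= j)%O]|.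
case: (@arg_maxnP _ i S F Si) => j Sj jmax; exists j => // k /jmax.
rewrite /geq /= leqNgt; apply: contra => jk; apply: proper_card; apply/properP; split.
  by apply/subsetP => x; rewrite !inE => /le_trans; apply; apply: ltW.
by exists k; rewrite !inE // lt_geF.
Qed.

Lemma min_elem (S : pred Lam) i : S i ->
  exists2 j, S j & forall k, S k -> ~~ (k < j)%O.
Proof.
move=> Si; pose F (j : Lam) := #|[pred x | (x <= j)%O]|.
case: (@arg_minnP _ i S F Si) => j Sj jmin; exists j => // k /jmin.
rewrite leqNgt; apply: contra => kj; apply: proper_card; apply/properP; split.
  by apply/subsetP => x; rewrite !inE => /le_trans; apply; apply: ltW.
by exists j; rewrite !inE // lt_geF.
Qed.

Lemma projP l : projective (P l). Proof. by case: (coverP l). Qed.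

Lemma epsP l : is_hom (eps l). Proof. by case: (coverP l). Qed.
Definition epsh l : hom (P l) (L l) := MkHom (@epsP l).
Lemma epsh_epi l : epi (epsh l). Proof. by apply/epiP; case: (coverP l). Qed.

Lemma L_nz l : exists x : L l, x <> 0.
Proof.
case: simplesL => /(_ l) [nz _] _ _; apply: contrapT => h; apply: nz.
apply/eqP; rewrite -subv0; apply/subvP => x _; rewrite memv0; apply/eqP.
by apply: contrapT => x0; apply: h; exists x.
Qed.

Lemma epi_to_simple M l (f : hom M (L l)) x : f x <> 0 -> epi f.
Proof.
case: simplesL => /(_ l) [_ /(_ (immod f)) h] _ _ fx.
case: h => /= e; last by apply/epiP.
case: fx; apply/eqP; rewrite -memv0 -e; apply/immodP; by exists x.
Qed.

Lemma mono_from_simple N l (f : hom (L l) N) x : f x <> 0 -> mono f.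
Proof.
case: simplesL => /(_ l) [_ /(_ (kermod f)) h] _ _ fx.
case: h => /= e; first by apply/monoP.
by case: fx; apply/eqP; rewrite -memv_ker e memvf.
Qed.

Lemma hom_L_neq k l (f : hom (L k) (L l)) x : f x <> 0 -> k = l.
Proof.
move=> fx; have ef := epi_to_simple fx; have mf := mono_from_simple fx.
case: simplesL => _ h _; apply: h; apply/hisoP.
by have [g [gf fg]] := hiso_inv mf ef; exists f, g.
Qed.

(** * Composition factors detected by maps from projective covers *)

(** Otherwise ker f maps onto the simple top, so ker f + ker eps = P(l), and the cover property
    forces f = 0. *)
Lemma cover_ker_max l N (f : hom (P l) N) y : f y <> 0 ->
  forall x, f x = 0 -> epsh l x = 0.
Proof.
move=> fy x fx; apply: contrapT => ex; apply: fy.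
pose j := hincl (kermod f).
have [z jz] : exists z, j z = x by apply/(hker_ex f).
have ej : epi (hcomp (epsh l) j) by apply: (@epi_to_simple _ _ _ z); rewrite hcompE jz.
have sum_full : (kermod f + lker (eps l))%VS = fullv.
  apply/eqP; rewrite eqEsubv subvf; apply/subvP => w _.
  have [u eu] := ej (epsh l w).
  rewrite -[w](subrK (j u)) addrC; apply: memv_add; first by apply/hincl_im; exists u.
  by rewrite memv_ker; apply/eqP; rewrite -[LHS]/(epsh l _) homB -eu hcompE subrr.
case: (coverP l) => _ _ _ /(_ _ sum_full) /= e.
by apply/eqP; rewrite -memv_ker e memvf.
Qed.

(* L(l) is not a composition factor of M, see nosupp_factor. *)
Definition nosupp l M := forall (f : hom (P l) M) x, f x = 0.

Lemma nosupp_sub l M N (f : hom M N) : mono f -> nosupp l N -> nosupp l M.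
Proof. by move=> mf h g x; apply: mf; rewrite -hcompE h. Qed.

Lemma nosupp_quot l M N (f : hom M N) : epi f -> nosupp l M -> nosupp l N.
Proof.
move=> ef h g x; have [g' gE] := proj_lift g (@projP l) ef.
by rewrite -gE h hom0.
Qed.

Lemma nosupp_ext l M N Q (f : hom M N) (g : hom N Q) : ses f g ->
  nosupp l M -> nosupp l Q -> nosupp l N.
Proof.
move=> [mf eg ex] hM hQ h x.
have [h' hE] : exists h' : hom (P l) M, forall y, f (h' y) = h y.
  by apply: factor_mono => // y; apply/ex; rewrite -hcompE hQ.
by rewrite -hE hM hom0.
Qed.

Lemma nosupp_iso l M N : hiso M N -> nosupp l M -> nosupp l N.
Proof. by move=> [f [g [gf fg]]]; apply: (@nosupp_sub l N M g); apply: can_mono fg. Qed.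

Lemma nosupp_fil l (S : fdmod A -> Prop) : (forall M, S M -> nosupp l M) ->
  forall M, fil S M -> nosupp l M.
Proof.
move=> h M; elim=> {M} [M M0 f x|M M' /h e /nosupp_iso|M1 M M2 a b s _ h1 _ h2].
- exact: M0.
- exact.
exact: nosupp_ext s h1 h2.
Qed.

(** By [cover_ker_max], [epsh k] factors through a nonzero P(k) -> L(l), which gives a nonzero map
    L(l) -> L(k). *)
Lemma nosupp_L k l : k <> l -> nosupp k (L l).
Proof.
move=> kl f x; apply: contrapT => fx; apply: kl.
have ef := epi_to_simple fx.
have [g gE] := factor_epi ef (cover_ker_max fx).
have [z z0] := L_nz k; have [w ew] := @epsh_epi k z.
by apply/esym/(@hom_L_neq l k g (f w)); rewrite gE ew.
Qed.

(** * Standard modules and their duals *)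

Definition delta l := Delta P l.
Definition Pker l : fdmod A := subM (std_kernel P l).
Definition Pker_in l : hom (Pker l) (P l) := hincl (std_kernel P l).
Definition delta_pi l : hom (P l) (delta l) := hquot (std_kernel P l).
Lemma delta_pi_ses l : ses (Pker_in l) (delta_pi l). Proof. exact: sub_ses. Qed.
Lemma delta_pi_epi l : epi (delta_pi l). Proof. by case: (delta_pi_ses l). Qed.

Lemma delta_top l : exists q : hom (delta l) (L l),
  (forall x, q (delta_pi l x) = epsh l x) /\
  fil (fun N => exists2 m, (m < l)%O & N = L m) (subM (kermod q)).
Proof.
case: (qhP l) => _ [q [hq [e [s fs hs]]]].
exists (MkHom hq); split=> [x|].
  by rewrite -[RHS]/(eps l x) -e lfun_valE.
exact: (filtration_fil fs hs).
Qed.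

Definition delta_q l : hom (delta l) (L l) := sval (cid (delta_top l)).
Lemma delta_qE l x : delta_q l (delta_pi l x) = epsh l x.
Proof. by case: (svalP (cid (delta_top l))). Qed.
Definition delta_rad l := subM (kermod (delta_q l)).
Lemma delta_rad_fil l : fil (fun N => exists2 m, (m < l)%O & N = L m) (delta_rad l).
Proof. by case: (svalP (cid (delta_top l))). Qed.

Lemma delta_q_epi l : epi (delta_q l).
Proof. by move=> y; have [x <-] := @epsh_epi l y; exists (delta_pi l x); rewrite delta_qE. Qed.

Lemma rad_ses l : ses (hincl (kermod (delta_q l))) (delta_q l).
Proof. by split; [exact: hincl_mono | exact: delta_q_epi | exact: hker_ex]. Qed.

Lemma Pker_fil l : fil (fun N => exists2 m, (l < m)%O & N = delta m) (Pker l).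
Proof. by case: (qhP l) => -[s fs hs] _; apply: filtration_fil fs hs. Qed.

Lemma nosupp_rad k l : ~~ (k < l)%O -> nosupp k (delta_rad l).
Proof.
move=> kl; apply: nosupp_fil (@delta_rad_fil l) => M [m ml ->].
by apply: nosupp_L => e; rewrite e ml in kl.
Qed.

Lemma nosupp_delta k l : ~~ (k <= l)%O -> nosupp k (delta l).
Proof.
rewrite le_eqVlt negb_or => /andP[/eqP kl k'l].
exact: nosupp_ext (rad_ses l) (nosupp_rad k'l) (nosupp_L kl).
Qed.

Lemma hom_delta0 l M (f : hom (delta l) M) : nosupp l M -> forall x, f x = 0.
Proof. by move=> h x; have [y <-] := @delta_pi_epi l x; rewrite -hcompE h. Qed.

(** The image U of a nonzero P(l) -> D M maps onto L(l). Dually D L(l), isomorphic to L(l), embeds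
    in D U, a quotient of D D M; so L(l) would be a factor of M. *)
Lemma nosupp_D l M : nosupp l M -> nosupp l (D M).
Proof.
move=> hM f x; apply: contrapT => fx.
pose U := subM (immod f); pose j : hom U (D M) := hincl (immod f).
have mj : mono j by exact: hincl_mono.
have [s sE] : exists s : hom (P l) U, forall y, j (s y) = f y.
  by apply: factor_mono => // y; apply/hincl_im/immodP; exists y.
have es : epi s.
  move=> u; have /immodP[y fy] : j u \in limg f by apply/(hincl_im (immod f)); exists u.
  by exists y; apply: (mono_inj mj); rewrite sE fy.
have [t tE] : exists t : hom U (L l), forall y, t (s y) = epsh l y.
  by apply: factor_epi => // y sy; apply: (cover_ker_max fx); rewrite -sE sy hom0.
have et : epi t by move=> z; have [y <-] := @epsh_epi l z; exists (s y).
have /hisoP[v [u [uv vu]]] : iso (D (L l)) (L l) by apply: simpleD; case: simplesL.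
have [w wE] := proj_lift (hcomp (Dm t) (hcomp u (epsh l))) (@projP l) (Dm_epi mj).
have [z z0] := L_nz l; have [y ey] := @epsh_epi l z; apply: z0.
have := wE y; rewrite (nosupp_iso (iso_DD M) hM) hom0 !hcompE ey => /esym.
by move=> /(Dm_mono et) /(can_mono vu).
Qed.

(* A model of the costandard module: the theorem only uses that the given nabla l
   is Ext-orthogonal to all Delta(m), never that it is isomorphic to nab l. *)
Definition nab l : fdmod A := D (delta l).

Lemma nosupp_nab k l : ~~ (k <= l)%O -> nosupp k (nab l).
Proof. by move=> kl; apply/nosupp_D/nosupp_delta. Qed.

Lemma dsum_hom0 (s : seq Lam) N (f : hom (dsum [seq P m | m <- s]) N) :
  (forall m, m \in s -> nosupp m N) -> forall x, f x = 0.
Proof.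
elim: s f => [|m s IH] f h x.
  by have -> : x = 0; [apply/rowP; case | rewrite hom0].
have -> : x = hinl (P m) _ x.1 + hinr _ _ x.2.
  by rewrite hinlE hinrE; case: x => a b; congr pair; rewrite ?addr0 ?add0r.
rewrite homD -!hcompE h ?mem_head // IH ?addr0 // => k ks.
by apply: h; rewrite inE ks orbT.
Qed.

(** [Pker l] is generated by images of the P(k) with k > l, and f kills each of these images. *)
Lemma hom_Pker0 l N (f : hom (Pker l) N) : (forall k, (l < k)%O -> nosupp k N) ->
  forall x, f x = 0.
Proof.
move=> h x; pose U := immod (hcomp (Pker_in l) (hincl (kermod f))).
have sub : (std_kernel P l <= U)%VS.
  apply: trace_min => g hg; apply/subvP => y /(immodP (MkHom hg))[w <-].
  have [g' gE] : exists g' : hom (dsum [seq P m | m <- enum Lam & (l < m)%O])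
      (Pker l), forall z, Pker_in l (g' z) = MkHom hg z.
    apply: factor_mono => [|z]; first exact: hincl_mono.
    apply/hincl_im; apply: (subvP (limg_trace hg)); rewrite memv_img ?memvf //.
  have fg0 z : hcomp f g' z = 0.
    by apply: dsum_hom0 => m; rewrite mem_filter => /andP[/h].
  have /(hker_ex f)[z jz] : f (g' w) = 0 by rewrite -hcompE.
  by apply/immodP; exists z; rewrite hcompE jz gE.
have : Pker_in l x \in (U : {vspace _}) by apply: (subvP sub); apply/hincl_im; exists x.
case/immodP=> z; rewrite hcompE => /(mono_inj (@hincl_mono _ _ _ (std_kernel P l))) <-.
by apply/(hker_ex f); exists z.
Qed.

Lemma ext0_delta l N : (forall k, (l < k)%O -> nosupp k N) -> ext0 (delta l) N.
Proof.
move=> h; apply: (ext0_pres (@projP l) (delta_pi_ses l)) => f.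
by exists (hzero _ _) => x; rewrite hzeroE hom_Pker0.
Qed.

Lemma delta_lift l N (f : hom (P l) N) : (forall k, (l < k)%O -> nosupp k N) ->
  exists g : hom (delta l) N, forall x, g (delta_pi l x) = f x.
Proof.
move=> h; apply: factor_epi (@delta_pi_epi l) _ => x.
by case: (delta_pi_ses l) => _ _ ex /ex[y <-]; rewrite -hcompE hom_Pker0.
Qed.

Lemma ext0_delta_delta l m : ~~ (l < m)%O -> ext0 (delta l) (delta m).
Proof.
move=> lm; apply: ext0_delta => k lk; apply: nosupp_delta.
by apply: contra lm; apply: lt_le_trans.
Qed.

Lemma ext0_D_swap M l : (forall k, (l < k)%O -> nosupp k M) -> ext0 M (nab l).
Proof.
move=> h; apply: ext0_DD; apply: ext0_isol (iso_DD _) _; apply: ext0_delta => k lk.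
exact/nosupp_D/h.
Qed.

(** If l < m, no factor of Delta(l) is above m and the dual criterion applies; otherwise no factor
    of nab(m) is above l. *)
Lemma ext0_delta_nab l m : ext0 (delta l) (nab m).
Proof.
have [lm|lm] := boolP (l < m)%O.
  apply: ext0_D_swap => k mk; apply: nosupp_delta; apply/negP => kl.
  by have := lt_trans lm (lt_le_trans mk kl); rewrite ltxx.
apply: ext0_delta => k lk; apply: nosupp_nab; apply: contra lm; exact: lt_le_trans.
Qed.

Lemma hom_delta_nab_le l m (f : hom (delta l) (nab m)) x : f x <> 0 -> (l <= m)%O.
Proof.
by move=> fx; apply: contraT => lm; case: fx; apply: hom_delta0; apply: nosupp_nab.
Qed.

(** A nonzero map gives l <= m, and its dual, a map Delta(m) -> nab(l), gives m <= l. *)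
Lemma hom_delta_nab0 l m (f : hom (delta l) (nab m)) : l <> m -> forall x, f x = 0.
Proof.
move=> lm x; apply: contrapT => fx; apply: lm.
apply/eqP; rewrite eq_le (hom_delta_nab_le fx); apply: contraT => ml; case: fx.
apply: Dm_faith0 => y; have [z <-] := eta_epi y.
by rewrite -hcompE hom_delta0 //; apply: nosupp_nab.
Qed.

Lemma delta_ker_max l N (f : hom (delta l) N) y : f y <> 0 ->
  forall x, f x = 0 -> delta_q l x = 0.
Proof.
move=> fy x; have [x' <-] := @delta_pi_epi l x; have [y' yE] := @delta_pi_epi l y.
rewrite -yE -hcompE in fy.
by move=> fx; rewrite delta_qE; apply: (cover_ker_max fy); rewrite hcompE.
Qed.

Lemma rad_nab0 l (f : hom (delta_rad l) (nab l)) x : f x = 0.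
Proof.
apply: Dm_faith0 => y; have [z <-] := eta_epi y.
by rewrite -hcompE hom_delta0 //; apply/nosupp_D/nosupp_rad; rewrite ltxx.
Qed.

Lemma rad_L0 l (f : hom (delta_rad l) (L l)) x : f x = 0.
Proof.
apply: fil_hom0 (@delta_rad_fil l) _ _ => M [m ml ->] g y.
by apply: contrapT => /hom_L_neq e; rewrite e ltxx in ml.
Qed.

Lemma End_L l (f : hom (L l) (L l)) : exists k : K, forall x, f x = k *: x.
Proof.
have [k e] := splitL (homP f); exists k => x.
by rewrite e !lfun_valE.
Qed.

Lemma hom_delta_L l (f : hom (delta l) (L l)) :
  exists k : K, forall x, f x = k *: delta_q l x.
Proof.
have [g gE] : exists g : hom (L l) (L l), forall x, g (delta_q l x) = f x.
  apply: factor_epi (@delta_q_epi l) _ => x /(hker_ex (delta_q l))[y <-].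
  by rewrite -hcompE rad_L0.
by have [k kE] := End_L g; exists k => x; rewrite -gE kE.
Qed.

(** Modulo a scalar f takes values in the radical, which has no factor L(l). *)
Lemma End_delta l (f : hom (delta l) (delta l)) : exists k : K, forall x, f x = k *: x.
Proof.
have [k kE] := hom_delta_L (hcomp (delta_q l) f); exists k => x.
pose f' := hsub f (hscale k (hid (delta l))).
have [g gE] : exists g : hom (delta l) (delta_rad l),
    forall y, hincl (kermod (delta_q l)) (g y) = f' y.
  apply: factor_mono => [|y]; first exact: hincl_mono.
  apply/(hker_ex (delta_q l)); rewrite hsubE hscaleE hidE homB homZ -hcompE kE.
  exact: subrr.
apply/eqP; rewrite -subr_eq0 -{2}[x](hidE) -hscaleE -hsubE -gE.
by rewrite hom_delta0 ?hom0 //; apply: nosupp_rad; rewrite ltxx.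
Qed.

(** c is Delta(l) -> L(l) = D L(l) -> nab(l). Any f kills the radical and has values in D L(l),
    since L(l) is not a factor of the radical or its dual; splitness then gives the scalar. *)
Lemma delta_nab_ex l : exists c : hom (delta l) (nab l), (exists x, c x <> 0) /\
  forall f : hom (delta l) (nab l), exists k : K, forall x, f x = k *: c x.
Proof.
have /hisoP[v [u [uv vu]]] : iso (D (L l)) (L l) by apply: simpleD; case: simplesL.
have eq := @delta_q_epi l.
have [mD _ exq] := Dm_ses (rad_ses l).
exists (hcomp (Dm (delta_q l)) (hcomp u (delta_q l))); split=> [|f].
  have [z z0] := L_nz l; have [x qx] := eq z; exists x.
  by rewrite !hcompE qx => /mD /(can_mono vu).
have [g gE] : exists g : hom (L l) (nab l), forall x, g (delta_q l x) = f x.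
  apply: factor_epi eq _ => x /(hker_ex (delta_q l))[y <-].
  by rewrite -hcompE rad_nab0.
have [h hE] : exists h : hom (L l) (D (L l)), forall x, Dm (delta_q l) (h x) = g x.
  apply: factor_mono => // z; apply/exq.
  have [x <-] := @epsh_epi l z; rewrite -!hcompE.
  by apply: nosupp_D; apply: nosupp_rad; rewrite ltxx.
have [k kE] := End_L (hcomp v h); exists k => x.
by rewrite -gE -hE !hcompE -(homZ (Dm _)) -(homZ u) -kE hcompE uv.
Qed.

Lemma simple_quot M (x : M) : x <> 0 -> exists l (f : hom M (L l)), epi f.
Proof.
have [n] := ubnP (\dim {:M}); elim: n M x => // n IH M x Mn x0.
have [sM|nsM] := pselect (simple M).
  case: simplesL => _ _ /(_ _ sM) [l /hisoP[f [g [gf fg]]]].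
  by exists l, f => y; exists (g y).
have [U [U0 U1]] : exists U : submod M,
    (U : {vspace M}) <> 0%VS /\ (U : {vspace M}) <> fullv.
  apply: contrapT => h; apply: nsM; split=> [e|U].
    by apply: x0; apply/eqP; rewrite -memv0 -e memvf.
  have [U0|U0] := pselect ((U : {vspace M}) = 0%VS); first by left.
  right; apply: contrapT => U1; by apply: h; exists U.
have [y yU] : exists y, y \notin (U : {vspace M}).
  apply: contrapT => h; apply: U1; apply/eqP; rewrite eqEsubv subvf.
  by apply/subvP => y _; apply: contraT => yU; case: h; exists y.
have y0 : hquot U y <> 0 by move/hquot0; apply/negP.
have ltd : (\dim {:quotM U} < n)%N.
  rewrite -ltnS; apply: (leq_trans _ Mn); rewrite ltnS (ses_dim (sub_ses U)).
  rewrite -[X in (X < _)%N]add0n ltn_add2r lt0n; apply/eqP => d0.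
  apply: U0; apply/eqP; rewrite -subv0; apply/subvP => w.
  by move=> /hincl_im[w' <-]; rewrite (dim0_eq0 w' d0) hom0 mem0v.
have [l [f ef]] := IH _ _ ltd y0.
exists l, (hcomp f (hquot U)) => z; have [w <-] := ef z.
by have [v <-] := hquot_epi w; exists v; rewrite hcompE.
Qed.

Lemma supp_nz M (x : M) : x <> 0 -> exists l, ~ nosupp l M.
Proof.
move=> /simple_quot[l [f ef]]; exists l => h.
have [g gE] := proj_lift (epsh l) (@projP l) ef.
have [z z0] := L_nz l; have [y ey] := @epsh_epi l z; apply: z0.
by rewrite -ey -gE h hom0.
Qed.

Lemma supp_max M (x : M) : x <> 0 ->
  exists2 l, ~ nosupp l M & forall k, (l < k)%O -> nosupp k M.
Proof.
move=> /supp_nz[l /asboolP h].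
have [k /asboolP hk kmax] := @max_elem (fun l => `[< ~ nosupp l M >]) l h.
exists k => // k' kk'; apply: contrapT => /asboolP h'.
by have := kmax _ h'; rewrite kk'.
Qed.

(** * The Ext criterion for Delta-filtrations *)

Definition dfil (S : pred Lam) := fil (fun N => exists2 m, S m & N = delta m).

Lemma dfil_sub (S S' : pred Lam) M : (forall m, S m -> S' m) -> dfil S M -> dfil S' M.
Proof. by move=> h; apply: fil_sub => N [m /h Sm e]; exists m. Qed.

Lemma dfil_delta (S : pred Lam) m : S m -> dfil S (delta m).
Proof.
move=> Sm; apply: (@fil_std _ _ _ (delta m)); first by exists m.
by exists (hid _), (hid _); split=> x; rewrite !hidE.
Qed.

Lemma dfil_ext0 (S : pred Lam) M N : (forall m, S m -> ext0 (delta m) N) ->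
  dfil S M -> ext0 M N.
Proof. by move=> h; apply: fil_ext0 => _ [m Sm ->]; apply: h. Qed.

Lemma dfil_ext0_r (S : pred Lam) M N : (forall m, S m -> ext0 N (delta m)) ->
  dfil S M -> ext0 N M.
Proof. by move=> h; apply: fil_ext0_r => _ [m Sm ->]; apply: h. Qed.

(** Stands in for the vanishing of Ext^2(M2, N). For M2 = Delta(m) the dimension shift [ext0_ker]
    leads to Ext^1([Pker m], N), where [Pker m] is again filtered by standard modules. *)
Lemma ext0_kernel N M2 : (forall m, ext0 (delta m) N) -> dfil predT M2 ->
  forall M1 M (a : hom M1 M) (b : hom M M2), ses a b -> ext0 M N -> ext0 M1 N.
Proof.
move=> hN; elim=> {M2} [M2 M20 M1 M a b [ma eb ex]
  |M2' M2 [m _ ->] [u [v [vu uv]]] M1 M a b s|].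
- apply: ext0_isol; apply: hiso_sym.
  have ea : epi a by move=> y; apply/ex.
  by have [g [h1 h2]] := hiso_inv ma ea; exists a, g.
- move=> eM; have eu : epi u by move=> y; exists (v y).
  have eK : ext0 (Pker m) N by apply: dfil_ext0 (@Pker_fil m) => k _.
  exact: ext0_ker (@projP m) (ses_iso_r (delta_pi_ses m) (can_mono vu) eu) s eM eK.
move=> N1 M2 N2 a' b' s' _ IH1 _ IH2 M1 M a b s eM.
have [V [j [i [r [sj si _ _]]]]] := ses_pull s s'.
exact: IH1 si (IH2 _ _ _ _ sj eM).
Qed.

(* Equivalent to having a Delta-filtration, see extN_dfil. *)
Definition extN M := forall m, ext0 M (nab m).

(** For m = l, C has no factor above l. For m different from l, maps from the image of h to nab(m)
    vanish, so Ext^1(C, nab(m)) embeds in Ext^1(M, nab(m)). *)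
Lemma extN_coker l M C (h : hom (delta l) M) (p : hom M C) :
  (forall k, (l < k)%O -> nosupp k M) -> epi p -> exact h p -> extN M -> extN C.
Proof.
move=> mx ep ex eM m.
have [lm|/eqP lm] := eqVneq l m.
  rewrite -lm; apply: ext0_D_swap => k /mx; exact: nosupp_quot.
pose j := hincl (immod h).
have sj : ses j p.
  split=> //; first exact: hincl_mono.
  by move=> y; rewrite ex hincl_im immodP.
apply: (ext0_quot sj (eM m)) => f; exists (hzero _ _) => x; rewrite hzeroE.
have [h' hE] : exists h' : hom (delta l) (subM (immod h)), forall x, j (h' x) = h x.
  apply: factor_mono; first exact: hincl_mono.
  by move=> y; apply/hincl_im/immodP; exists y.
have /immodP[y yE] : j x \in limg h by apply/(hincl_im (immod h)); exists x.
have -> : x = h' y by apply: (mono_inj (@hincl_mono _ _ _ (immod h))); rewrite hE yE.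
by rewrite -hcompE hom_delta_nab0.
Qed.

Lemma L_nab l : exists f : hom (L l) (nab l), mono f.
Proof.
have /hisoP[v [u [uv vu]]] : iso (D (L l)) (L l) by apply: simpleD; case: simplesL.
exists (hcomp (Dm (delta_q l)) u) => x; rewrite hcompE => /(Dm_mono (@delta_q_epi l)).
exact: can_mono vu x.
Qed.

(** If ker h is nonzero, some map ker h -> L(k) -> nab(k) is nonzero. It extends to Delta(l),
    because Ext^1 from the image of h to nab(k) vanishes. This is absurd: for k different from l by
    [hom_delta_nab0], and for k = l because ker h lies in the radical. *)
Lemma delta_mono l M C (h : hom (delta l) M) (p : hom M C) x :
  h x <> 0 -> epi p -> exact h p -> extN M -> dfil predT C -> mono h.
Proof.
move=> hx ep ex eM fC z hz; apply: contrapT => z0.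
pose j := hincl (immod h).
have sj : ses j p.
  split=> //; first exact: hincl_mono.
  by move=> y; rewrite ex hincl_im immodP.
have [h' hE] : exists h' : hom (delta l) (subM (immod h)), forall x, j (h' x) = h x.
  apply: factor_mono; first exact: hincl_mono.
  by move=> y; apply/hincl_im/immodP; exists y.
have sh : ses (hincl (kermod h)) h'.
  split; first exact: hincl_mono.
    move=> u; have /immodP[y yE] : j u \in limg h by apply/(hincl_im (immod h)); exists u.
    by exists y; apply: (mono_inj (@hincl_mono _ _ _ (immod h))); rewrite hE yE.
  move=> y; rewrite -(hker_ex h y) -hE; split=> [->|]; first exact: hom0.
  exact: (@hincl_mono _ _ _ (immod h)).
have [z' zE] : exists z', hincl (kermod h) z' = z by apply/(hker_ex h).
have [k [f ef]] : exists k (f : hom (subM (kermod h)) (L k)), epi f.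
  by apply: (@simple_quot _ z') => z'0; apply: z0; rewrite -zE z'0 hom0.
have [w w0] := L_nz k; apply: w0; have [y <-] := ef w.
have [c mc] := L_nab k; apply: mc.
have eU : ext0 (subM (immod h)) (nab k).
  by apply: ext0_kernel fC _ _ _ _ sj (eM k) => m; apply: ext0_delta_nab.
have [g gE] := eU _ _ _ _ sh (hcomp c f).
rewrite -hcompE -gE.
have [lk|/eqP lk] := eqVneq l k; last exact: hom_delta_nab0.
subst k.
have hy : h (hincl (kermod h) y) = 0 by apply/(hker_ex h); exists y.
have /(hker_ex (delta_q l))[t <-] := delta_ker_max hx hy.
by rewrite -hcompE rad_nab0.
Qed.

(** A standard submodule of maximal weight is split off. Its injectivity depends on the filtration
    of the cokernel, so the induction hypothesis comes before [delta_mono]. *)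
Lemma extN_dfil M : extN M -> dfil predT M.
Proof.
have [n] := ubnP (\dim {:M}); elim: n M => // n IH M Mn eM.
have [M0|] := pselect (forall m : M, m = 0); first exact: fil_zero.
case/existsNP=> x x0; have [l nl mx] := supp_max x0.
have [f [y fy]] : exists (f : hom (P l) M) y, f y <> 0.
  apply: contrapT => h; apply: nl => f y; apply: contrapT => fy.
  by apply: h; exists f, y.
have [h hE] := delta_lift f mx.
have hy : h (delta_pi l y) <> 0 by rewrite hE.
have [ep ex] := coker_ex h.
have fC : dfil predT (quotM (immod h)).
  apply: IH; last exact: extN_coker mx ep ex eM.
  rewrite -ltnS; apply: (leq_trans _ Mn); rewrite ltnS (ses_dim (sub_ses (immod h))).
  rewrite -[X in (X < _)%N]add0n ltn_add2r.
  have [w wE] : exists w, hincl (immod h) w = h (delta_pi l y).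
    by apply/hincl_im/immodP; exists (delta_pi l y).
  by apply: (@dim_gt0 _ _ _ w) => w0; apply: hy; rewrite -wE w0 hom0.
apply: (fil_ext (And3 (delta_mono hy ep ex eM fC) ep ex)) => //.
exact: dfil_delta.
Qed.

Lemma delta_sub_max l M (h : hom (delta l) M) x : extN M ->
  (forall k, (l < k)%O -> nosupp k M) -> h x <> 0 ->
  exists (C : fdmod A) (p : hom M C), ses h p /\ dfil predT C.
Proof.
move=> eM mx hx; have [ep ex] := coker_ex h.
have fC := extN_dfil (extN_coker mx ep ex eM).
exists (quotM (immod h)), (hquot (immod h)); split=> //; split=> //.
exact: delta_mono hx ep ex eM fC.
Qed.

(** * Universal extensions and tilting envelopes *)

(** M' is M + P(m) modulo the image of (f, inclusion). There (f x, 0) = -(0, x), hence the sign in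
    t. *)
Lemma pushout m M (f : hom (Pker m) M) :
  exists (M' : fdmod A) (i : hom M M') (p : hom M' (delta m)) (t : hom (P m) M'),
    ses i p /\ forall x, t (Pker_in m x) = i (f x).
Proof.
have [mk _ exk] := delta_pi_ses m.
pose s := hpair f (Pker_in m); have [eq exq] := coker_ex s; set q := hquot _ in eq exq.
have [p pE] : exists p : hom (quotM (immod s)) (delta m),
    forall x, p (q x) = hcomp (delta_pi m) (hsnd _ _) x.
  apply: factor_epi => // x /exq[z <-]; rewrite hcompE hsndE hpairE.
  by apply/exk; exists z.
exists (quotM (immod s)), (hcomp q (hinl _ _)), p, (hscale (-1) (hcomp q (hinr _ _))).
split; last first.
  move=> x; apply/eqP; rewrite hscaleE scaleN1r !hcompE hinlE hinrE.
  rewrite eq_sym -subr_eq0 opprK -homD; apply/eqP/exq; exists x; rewrite hpairE.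
  by congr pair; rewrite ?addr0 ?add0r.
split=> [x|y|y].
- rewrite hcompE hinlE => /exq[z].
  by rewrite hpairE => /prodM_inj[<- /mk ->]; rewrite hom0.
- by have [z <-] := @delta_pi_epi m y; exists (q (0, z)); rewrite pE hcompE hsndE.
have [w <-] := eq y; rewrite pE hcompE hsndE; split=> [/exk[z zb]|[x]].
  exists (w.1 - f z); rewrite hcompE hinlE; apply/eqP; rewrite -subr_eq0 -homB.
  apply/eqP/exq; exists (- z); rewrite hpairE !homN zb (surjective_pairing w).
  by congr pair; rewrite ?sub0r //= addrAC subrr sub0r.
rewrite hcompE hinlE => /eqP; rewrite -subr_eq0 -homB => /eqP/exq[z].
rewrite hpairE (surjective_pairing w) => /prodM_inj[_]; rewrite sub0r => e.
by apply/exk; exists (- z); rewrite homN e opprK.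
Qed.

Lemma dfil_ext S M N Q (f : hom M N) (g : hom N Q) :
  ses f g -> dfil S M -> dfil S Q -> dfil S N.
Proof. exact: fil_ext. Qed.

Lemma dfil_zero S : dfil S (zeroM A).
Proof. by apply: fil_zero => x; apply/rowP; case. Qed.

Lemma zero_ses M : ses (hid M) (hzero M (zeroM A)).
Proof.
split=> [x|y|x]; rewrite ?hidE ?hzeroE //.
  by exists 0; rewrite hom0; apply/rowP; case.
by split=> // _; exists x; rewrite hidE.
Qed.

(** One pushout for each basis vector of Hom([Pker m], M), which covers all classes in
    Ext^1(Delta(m), M). *)
Lemma universal_extension m M :
  exists (M' : fdmod A) (i : hom M M') (C : fdmod A) (p : hom M' C),
  [/\ ses i p, dfil (pred1 m) C
    & forall f : hom (Pker m) M,
       exists t : hom (P m) M', forall x, t (Pker_in m x) = i (f x)].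
Proof.
have hb f : f \in (vbasis (homspace (Pker m) M) : seq _) -> is_hom f.
  by move=> fb; apply/homspaceP; apply: vbasis_mem.
suff [M' [i [C [p [s fC ext]]]]] :
  exists (M' : fdmod A) (i : hom M M') (C : fdmod A) (p : hom M' C),
  [/\ ses i p, dfil (pred1 m) C
    & forall f, f \in (vbasis (homspace (Pker m) M) : seq _) ->
       exists t : hom (P m) M', forall x, t (Pker_in m x) = i (f x)].
  exists M', i, C, p; split=> // f.
  have : hom_fun f \in <<vbasis (homspace (Pker m) M)>>%VS.
    by rewrite (span_basis (vbasisP _)); apply/homspaceP; apply: homP.
  move: (hom_fun f) => {}f; elim: (vbasis _ : seq _) f ext {hb} => [|g gs IH] f ext.
    rewrite span_nil memv0 => /eqP ->; exists (hzero _ _) => x.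
    by rewrite hzeroE lfun_valE hom0.
  rewrite span_cons => /memv_addP[_ /vlineP[k ->] [f2 /IH h2 ->]].
  have [t tE] := ext g (mem_head _ _).
  have [t2 t2E] : exists t : hom (P m) M', forall x, t (Pker_in m x) = i (f2 x).
    by apply: h2 => f' f'gs; apply: ext; rewrite inE f'gs orbT.
  exists (hadd (hscale k t) t2) => x.
  by rewrite haddE hscaleE tE t2E !lfun_valE homD homZ.
elim: (vbasis _ : seq _) hb => [|g gs IH] hb.
  exists M, (hid M), (zeroM A), (hzero _ _); split=> //; first exact: zero_ses.
  exact: dfil_zero.
have hb' f : f \in gs -> is_hom f by move=> fgs; apply: hb; rewrite inE fgs orbT.
have [M1 [i1 [C1 [p1 [s1 f1 ext1]]]]] := IH hb'.
have [M2 [i2 [p2 [t [s2 tE]]]]] := pushout (hcomp i1 (MkHom (hb g (mem_head _ _)))).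
have [C [q [u [v [sq suv]]]]] := ses_comp s1 s2.
exists M2, (hcomp i2 i1), C, q; split=> //.
  by apply: dfil_ext suv f1 _; apply: dfil_delta; apply: eqxx.
move=> f; rewrite inE => /orP[/eqP->|/ext1[t1 t1E]].
  by exists t => x; rewrite tE !hcompE.
by exists (hcomp i2 t1) => x; rewrite !hcompE t1E.
Qed.

(** Since Delta(m) has no self-extensions, the image of f in C extends to P(m) and lifts to M'. The
    difference takes values in M, where the universal property applies. *)
Lemma universal_ext0 m M :
  exists (M' : fdmod A) (i : hom M M') (C : fdmod A) (p : hom M' C),
  [/\ ses i p, dfil (pred1 m) C & ext0 (delta m) M'].
Proof.
have [M' [i [C [p [s fC ext]]]]] := universal_extension m M.
exists M', i, C, p; split=> //; case: s => mi ep exi.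
apply: (ext0_pres (@projP m) (delta_pi_ses m)) => f.
have eC : ext0 (delta m) C.
  by apply: dfil_ext0_r fC => k /eqP ->; apply: ext0_delta_delta; rewrite ltxx.
have [t tE] := eC _ _ _ _ (delta_pi_ses m) (hcomp p f).
have [t' t'E] := proj_lift t (@projP m) ep.
have [g gE] : exists g : hom (Pker m) M,
    forall x, i (g x) = hsub f (hcomp t' (Pker_in m)) x.
  apply: factor_mono => // x; apply/exi.
  by rewrite hsubE homB hcompE t'E tE hcompE subrr.
have [r rE] := ext g.
exists (hadd t' r) => x.
by rewrite haddE rE gE hsubE hcompE addrC subrK.
Qed.

(** A minimal i in S is treated last: adding copies of Delta(i) can spoil the vanishing only for
    weights m < i. *)
Lemma envelope_set l (S : {set Lam}) : (forall m, m \in S -> (m < l)%O) ->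
  exists (Y : fdmod A) (h : hom (delta l) Y) (C : fdmod A) (p : hom Y C),
  [/\ ses h p, dfil (fun m => (m < l)%O) C & forall m, m \in S -> ext0 (delta m) Y].
Proof.
have [n] := ubnP #|S|; elim: n S => // n IH S Sn Sl.
have [S0|[i0 i0S]] := set_0Vmem S.
  exists (delta l), (hid _), (zeroM A), (hzero _ _); split.
  - exact: zero_ses.
  - exact: dfil_zero.
  by move=> m; rewrite S0 inE.
have [i /= iS imin] := @min_elem (fun k => k \in S) i0 i0S.
have [||Y [h [C [p [s fC eY]]]]] := IH (S :\ i).
- by move: Sn; rewrite (cardsD1 i) iS add1n ltnS.
- by move=> m /setD1P[_ /Sl].
have [Y' [j [C' [p' [s' fC' eY']]]]] := universal_ext0 i Y.
have [C2 [q [u [v [sq suv]]]]] := ses_comp s s'.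
exists Y', (hcomp j h), C2, q; split=> //.
  by apply: dfil_ext suv fC _; apply: dfil_sub fC' => m /eqP ->; apply: Sl.
move=> m mS; have [->//|mi] := eqVneq m i.
apply: ext0_extr s' (eY m _) _; first by rewrite !inE mi.
by apply: dfil_ext0_r fC' => k /eqP ->; apply: ext0_delta_delta; apply: imin.
Qed.

(* A tilting module containing Delta(l), possibly decomposable: the indecomposable
   tilting module of highest weight l plus summands of smaller highest weight. *)
Lemma envelope_exists l : exists e : {Y : fdmod A & hom (delta l) Y},
  (exists (C : fdmod A) (p : hom (projT1 e) C),
     ses (projT2 e) p /\ dfil (fun m => (m < l)%O) C) /\
  forall m, ext0 (delta m) (projT1 e).
Proof.
have [|Y [h [C [p [s fC eY]]]]] := @envelope_set l [set m | (m < l)%O].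
  by move=> m; rewrite inE.
exists (existT _ Y h) => /=; split=> [|m]; first by exists C, p.
have [ml|ml] := boolP (m < l)%O; first by apply: eY; rewrite inE.
apply: ext0_extr s _ _; first exact: ext0_delta_delta.
apply: dfil_ext0_r fC => k kl; apply: ext0_delta_delta.
by apply: contra ml => /lt_trans; apply.
Qed.

Definition env l : fdmod A := projT1 (sval (cid (envelope_exists l))).
Definition env_in l : hom (delta l) (env l) := projT2 (sval (cid (envelope_exists l))).

Lemma env_ses l : exists (C : fdmod A) (p : hom (env l) C),
  ses (env_in l) p /\ dfil (fun m => (m < l)%O) C.
Proof. by case: (svalP (cid (envelope_exists l))). Qed.

Lemma env_ext0 l m : ext0 (delta m) (env l).
Proof. by case: (svalP (cid (envelope_exists l))). Qed.

Lemma env_in_mono l : mono (env_in l).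
Proof. by have [C [p [[]]]] := env_ses l. Qed.

Lemma nosupp_dfil k (S : pred Lam) M : (forall m, S m -> ~~ (k <= m)%O) ->
  dfil S M -> nosupp k M.
Proof. by move=> h; apply: nosupp_fil => _ [m /h km ->]; apply: nosupp_delta. Qed.

Lemma env_extend l Z (f : hom (delta l) Z) : (forall m, ext0 (delta m) Z) ->
  exists g : hom (env l) Z, forall x, g (env_in l x) = f x.
Proof.
move=> eZ; have [C [p [s fC]]] := env_ses l.
by apply: (@dfil_ext0 _ C Z _ fC _ _ _ _ s) => m _.
Qed.

Lemma nosupp_env k l : ~~ (k <= l)%O -> nosupp k (env l).
Proof.
move=> kl; have [C [p [s fC]]] := env_ses l.
apply: nosupp_ext s (nosupp_delta kl) _; apply: nosupp_dfil fC => m ml.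
by apply: contra kl => /le_lt_trans/(_ ml)/ltW.
Qed.

(** The cokernel has only factors of weight not above or equal to l, so such a map factors through
    Delta(l), whose endomorphisms are scalars. *)
Lemma hom_delta_env l (f : hom (delta l) (env l)) :
  exists k : K, forall x, f x = k *: env_in l x.
Proof.
have [C [p [[mi ep ex] fC]]] := env_ses l.
have [g gE] : exists g : hom (delta l) (delta l), forall x, env_in l (g x) = f x.
  apply: factor_mono => // x; apply/ex; rewrite -hcompE hom_delta0 //.
  by apply: nosupp_dfil fC => m ml; rewrite lt_geF.
by have [k kE] := End_delta g; exists k => x; rewrite -gE kE homZ.
Qed.

(** * Tilting modules *)

(** Membership in F(nabla) and F(Delta) in Ext form; D exchanges the two conditions, and direct sums
    preserve them. *)
Definition tilt Z := (forall m, ext0 (delta m) Z) /\ extN Z.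

Lemma tilt_env l : tilt (env l).
Proof.
split=> m; first exact: env_ext0.
have [C [p [s fC]]] := env_ses l.
apply: ext0_extl s (@ext0_delta_nab _ _) _.
by apply: dfil_ext0 fC => k _; apply: ext0_delta_nab.
Qed.

Lemma tilt_D Z : tilt Z -> tilt (D Z).
Proof.
move=> [h1 h2]; split=> m; last exact: ext0_D.
apply: ext0_DD; exact: ext0_isol (iso_DD Z) (h2 m).
Qed.

Lemma tilt_prod X Y : tilt X -> tilt Y -> tilt (prodM X Y).
Proof. by move=> [h1 h2] [h3 h4]; split=> m; [apply: ext0_prodr | apply: ext0_prodl]. Qed.

Lemma tilt_zero : tilt (zeroM A).
Proof.
split=> m; last by apply: ext0_0 => x; apply/rowP; case.
by move=> X Y i p _ f; exists (hzero _ _) => x; rewrite hzeroE; apply/rowP; case.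
Qed.

(** If x dies in M2 it comes from M1, and a map from M1 to an envelope extends to M because
    Ext^1(M2, env k) = 0. *)
Lemma dfil_embed M (x : M) : dfil predT M -> x <> 0 ->
  exists k (f : hom M (env k)) (u : delta k), u <> 0 /\ f x = env_in k u.
Proof.
move=> fM; elim: fM x => {M} [M M0 x|M' M [m _ ->] [u [v [vu uv]]] x x0|].
- by rewrite (M0 x).
- exists m, (hcomp (env_in m) v), (v x); split; last by rewrite hcompE.
  by move/(can_mono uv).
move=> M1 M M2 a b [ma eb ex] _ IH1 f2 IH2 x x0.
have [bx|] := pselect (b x = 0); last first.
  by move=> /IH2[k [f [u [u0 fu]]]]; exists k, (hcomp f b), u; rewrite hcompE.
case/ex: bx => y ay.
have /IH1[k [f [u [u0 fu]]]] : y <> 0 by move=> y0; apply: x0; rewrite -ay y0 hom0.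
have [g gE] : exists g : hom M (env k), forall x, g (a x) = f x.
  apply: (@dfil_ext0 _ M2 (env k) _ f2 _ _ _ _ (And3 ma eb ex)) => m _.
  exact: env_ext0.
by exists k, g, u; rewrite -ay gE.
Qed.

(* The indecomposable tilting module with highest weight l is a summand of Z. *)
Definition split l Z :=
  exists (h : hom (delta l) Z) (f : hom Z (env l)), forall x, f (h x) = env_in l x.

Lemma split_pair l Z : split l Z ->
  exists (h : hom (delta l) Z) (g : hom Z (nab l)) x, g (h x) <> 0.
Proof.
move=> [h [f fh]]; have [c [[x cx] _]] := delta_nab_ex l.
have [g gE] := env_extend c (fun m => @ext0_delta_nab m l).
by exists h, (hcomp g f), x; rewrite hcompE fh gE.
Qed.

(* Both env l and its dual receive Delta(l) with a Delta-filtered cokernel, so the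
   map Delta(l) -> Z -> D(env l) lifting g extends back to env l. *)
Lemma pair_split l Z (h : hom (delta l) Z) (g : hom Z (nab l)) x :
  tilt Z -> g (h x) <> 0 -> split l Z.
Proof.
move=> tZ ghx; have [C [p [s fC]]] := env_ses l.
have eZ : ext0 Z (D C).
  apply: ext0_isol (hiso_sym (iso_DD Z)) _; apply: ext0_D.
  by apply: dfil_ext0 fC => m _; case: (tilt_D tZ).
have [g' g'E] := ext0_lift g eZ (Dm_ses s).
have h1x : hcomp g' h x <> 0.
  by rewrite hcompE => e; apply: ghx; rewrite -g'E e hom0.
have [C1 [p1 [s1 f1]]] : exists (C : fdmod A) (p : hom (D (env l)) C),
    ses (hcomp g' h) p /\ dfil predT C.
  apply: delta_sub_max h1x; first by case: (tilt_D (tilt_env l)).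
  by move=> k lk; apply/nosupp_D/nosupp_env; rewrite lt_geF.
have eC1 : ext0 C1 (env l) by apply: dfil_ext0 f1 => m _; apply: env_ext0.
have [b bE] := eC1 _ _ _ _ s1 (env_in l).
by exists h, (hcomp b g') => y; rewrite hcompE -(hcompE g').
Qed.

(** A nonzero composite Delta(l) -> Z -> nab(l) dualizes to one through D Z. *)
Lemma split_D l Z : tilt Z -> split l Z -> split l (D Z).
Proof.
move=> tZ /split_pair[h [g [x gh]]].
apply: contrapT => ns; apply: gh; rewrite -hcompE; apply: Dm_faith0 => y.
have [z <-] := eta_epi y; rewrite Dm_comp -(hcompE (Dm g)).
apply: contrapT => e; apply: ns; exact: (pair_split (tilt_D tZ) e).
Qed.

Lemma nonsplit l Z (h : hom (delta l) Z) (f : hom Z (env l)) : ~ split l Z ->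
  forall x, f (h x) = 0.
Proof.
move=> ns x; have [k kE] := hom_delta_env (hcomp f h).
rewrite -hcompE kE; have [->|k0] := eqVneq k 0; first by rewrite scale0r.
case: ns; exists h, (hscale k^-1 f) => y.
by rewrite hscaleE -hcompE kE scalerA mulVf // scale1r.
Qed.

(* u lies in the socle of Delta(l) for the category of tilting modules: it is
   killed by every map that is not split injective on the highest weight. *)
Definition sock l (u : delta l) := u <> 0 /\
  forall m (h : hom (delta l) (env m)),
    (forall (f : hom (env m) (env l)) x, f (h x) = 0) -> h u = 0.
Definition core l := exists u : delta l, sock u.

(** [sock] tests envelopes only; [dfil_embed] carries a nonzero h u into one of them. *)
Lemma sock_kill l (u : delta l) Z (h : hom (delta l) Z) :
  sock u -> tilt Z -> ~ split l Z -> h u = 0.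
Proof.
move=> [u0 su] [_ /extN_dfil fZ] ns; apply: contrapT => hu.
have [k [f [v [v0 fv]]]] := dfil_embed fZ hu.
apply: v0; apply: (@env_in_mono k); rewrite -fv -hcompE; apply: su => f' x.
by rewrite hcompE -(hcompE f' f) nonsplit.
Qed.

Definition cogen Z := forall l (u : delta l), u <> 0 ->
  exists h : hom (delta l) Z, h u <> 0.

(* Induction on the size of the End-submodule generated by u inside the envelopes:
   if u is not killed by some h in the radical, replace u by its image under h. *)
Lemma split_cogen Z : tilt Z -> (forall l, core l -> split l Z) -> cogen Z.
Proof.
move=> tZ hZ l u.
pose mu k (v : delta k) := (\sum_m \dim (homs_at (env m) v))%N.
have [n] := ubnP (mu l u); elim: n l u => // n IH l u un u0.
apply: contrapT => ns.
have kill (h : hom (delta l) Z) : h u = 0.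
  by apply: contrapT => hu; apply: ns; exists h.
have [rad|] := pselect (forall m (h : hom (delta l) (env m)),
    (forall (f : hom (env m) (env l)) x, f (h x) = 0) -> h u = 0).
  have [h [f fh]] : split l Z by apply: hZ; exists u.
  by apply/u0/(@env_in_mono l); rewrite -fh kill hom0.
case/existsNP=> m /existsNP[h /not_implyP[hrad hu]].
have [_ /extN_dfil fm] := tilt_env m.
have [k [F [v [v0 Fv]]]] := dfil_embed fm hu.
have sub m' : (homs_at (env m') v <= homs_at (env m') u)%VS.
  apply/subvP => _ /homs_atP[g <-].
  have [g' g'E] := env_extend g (fun i => @env_ext0 m' i).
  by apply/homs_atP; exists (hcomp g' (hcomp F h)); rewrite !hcompE Fv g'E.
have ltmu : (mu k v < mu l u)%N.
  (* The drop is strict at index l: otherwise [env_in l u] would be a value at v, hence f (h u) for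
     some f : env m -> env l, and every such f kills the image of h. *)
  rewrite /mu (bigD1 l) //= [X in (_ < X)%N](bigD1 l) //= -addSn.
  apply: leq_add; last by apply: leq_sum => i _; apply: dimvS.
  rewrite ltnNge; apply/negP => le.
  have /eqP e : homs_at (env l) v == homs_at (env l) u by rewrite eqEdim sub.
  have : env_in l u \in homs_at (env l) v by rewrite e; apply/homs_atP; exists (env_in l).
  case/homs_atP=> g gv.
  have [g' g'E] := env_extend g (fun i => @env_ext0 l i).
  apply/u0/(@env_in_mono l); rewrite -gv -g'E -Fv -(hcompE g') hrad //.
have [h' h'v] := IH k v (leq_trans ltmu un) v0.
have [g gE] := env_extend h' (proj1 tZ).
by apply: h'v; rewrite -gE -Fv -!hcompE kill.
Qed.

Lemma dfil_cogen Z M (x : M) : (forall m, ext0 (delta m) Z) -> cogen Z ->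
  dfil predT M -> x <> 0 -> exists f : hom M Z, f x <> 0.
Proof.
move=> eZ cZ fM x0; have [k [f [u [u0 fu]]]] := dfil_embed fM x0.
have [h hu] := cZ k u u0; have [g gE] := env_extend h eZ.
by exists (hcomp g f); rewrite hcompE fu gE.
Qed.

(** If the trace is proper, its quotient gives a nonzero element of D nab(l), that is of Delta(l). A
    map Delta(l) -> D Z not killing it is dual to a map Z -> nab(l) whose image is not inside the
    trace. *)
Lemma cogen_gen Z l (v : nab l) : cogen (D Z) -> v \in traceV Z (nab l).
Proof.
move=> cD; apply: contraT => vT.
pose q := hquot (trace Z (nab l)).
have [y qy] : exists y, Dm q y <> 0.
  apply: contrapT => h; move/negP: vT; apply; apply/(hquot0 (trace Z (nab l))).
  apply: (@Dm_faith0 _ _ q) => y; apply: contrapT => qy; apply: h; by exists y.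
have [u eu] := eta_epi (Dm q y).
have /cD[h hu] : u <> 0 by move=> u0; apply: qy; rewrite -eu u0 hom0.
have [e' [e'1 e'2]] := hiso_inv (@eta_mono (delta l)) (@eta_epi (delta l)).
have [g gE] := Dm_full (hcomp h e').
case: hu; rewrite -(e'1 u) eu -(hcompE h) -gE -Dm_comp.
apply: Dm_0 => z; rewrite hcompE; apply/hquot0.
by apply: (subvP (limg_trace (homP g))); rewrite memv_img ?memvf.
Qed.

Lemma tilt_power Z n : tilt Z -> tilt (dsum (nseq n Z)).
Proof. by move=> tZ; elim: n => [|n IH]; [apply: tilt_zero | apply: tilt_prod]. Qed.

(** * Double centralizers from cogeneration *)

Section Star.
Variable Z : fdmod A.
Hypotheses (tZ : tilt Z) (faithZ : faithful Z) (cZ : cogen Z) (cDZ : cogen (D Z)).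

(** Orbit maps a -> a y of the basis vectors y; their tuple sends 1 to the whole basis. *)
Definition basis_map : seq (hom (regM A) Z) :=
  [seq sval (cid (reg_hom y)) | y <- (vbasis {:Z} : seq Z)].
Local Notation n := (size basis_map).
Definition basis_hom := htuple basis_map.

Lemma size_basis_map : n = \dim {:Z}.
Proof. by rewrite size_map size_tuple. Qed.

Lemma basis_mapE i (a : A) : (i < \dim {:Z})%N ->
  nth (hzero _ _) basis_map i a = act Z a (vbasis {:Z})`_i.
Proof.
move=> iZ; rewrite (nth_map 0) ?size_tuple //.
exact: (svalP (cid (reg_hom (vbasis {:Z})`_i)) a).
Qed.

Lemma lfun_basis (f g : 'End(Z)) :
  (forall i, (i < \dim {:Z})%N -> f (vbasis {:Z})`_i = g (vbasis {:Z})`_i) -> f = g.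
Proof.
move=> h; apply/lfunP => z; rewrite (coord_vbasis (memvf z)) !linear_sum.
by apply: eq_bigr => i _; rewrite !linearZ /= h.
Qed.

Lemma basis_hom_mono : mono basis_hom.
Proof.
move=> a ha; apply: faithZ; rewrite linear0; apply: lfun_basis => i iZ.
have [|p pE] := @htuple_proj _ _ _ _ basis_map i; first by rewrite size_basis_map.
by rewrite -basis_mapE // -pE ha hom0 lfun_valE.
Qed.

(** A map A -> nab(m) is given by the image of 1, a sum of values g(z) with g : Z -> nab(m). Each z
    is a combination of the coordinates of [basis_hom one], so the map extends to the power. *)
Lemma basis_coker : dfil predT (quotM (immod basis_hom)).
Proof.
have [ep ex] := coker_ex basis_hom.
apply: extN_dfil => m; apply: (ext0_quot (And3 basis_hom_mono ep ex)).
  exact: (proj2 (tilt_power n tZ) m).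
move=> f; pose one : regM A := (1 : A).
have sub : (traceV Z (nab m) <= homs_at (nab m) (basis_hom one))%VS.
  apply: trace_min => g hg; apply/subvP => _ /memv_imgP[z _ ->].
  rewrite (coord_vbasis (memvf z)) linear_sum; apply: memv_suml => i _.
  rewrite linearZ /=; apply: memvZ; apply/homs_atP.
  have [|p pE] := @htuple_proj _ _ _ _ basis_map i; first by rewrite size_basis_map.
  exists (hcomp (MkHom hg) p); rewrite hcompE pE basis_mapE //.
  by rewrite /= act1 lfun_valE.
have /homs_atP[g gE] := subvP sub _ (cogen_gen (f one) cDZ).
exists g => a; have -> : a = act (regM A) a one by rewrite /= lfunE /= mulr1.
by rewrite !homA gE.
Qed.

(** Applying a to every coordinate of [basis_hom one] gives an element killed by all maps to Z that
    vanish on the image of A. As Z cogenerates the cokernel, it is [basis_hom b] for some b. *)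
Lemma tilt_double_centralizer : double_centralizer Z.
Proof.
move=> a ha; pose one : regM A := (1 : A).
have comm (f : hom Z Z) x : f (a x) = a (f x).
  by have /lfunP/(_ x) := ha f (homP f); rewrite !lfun_valE.
have [b bE] : exists b, basis_hom b = power_map a (basis_hom one).
  have [_ ex] := coker_ex basis_hom; apply/ex; apply: contrapT => h.
  have [f] := dfil_cogen (proj1 tZ) cZ basis_coker h; apply.
  rewrite -hcompE power_map_comm // hcompE.
  have -> : hquot (immod basis_hom) (basis_hom one) = 0 by apply/ex; exists one.
  by rewrite hom0 linear0.
exists b; apply: lfun_basis => i iZ.
have [|p pE] := @htuple_proj _ _ _ _ basis_map i; first by rewrite size_basis_map.
rewrite -basis_mapE // -pE bE power_map_comm // pE basis_mapE //.
by rewrite act1 lfun_valE.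
Qed.

Lemma tilt_coresolution : coresolution Z (regM A) 2.
Proof.
have [ep ex] := coker_ex basis_hom.
have [fs fsP] := cogen_list (quotM (immod basis_hom)) Z.
exists (dsum (nseq n Z)), basis_hom; split.
- exact: in_add_power.
- exact: homP.
- have /monoP -> := basis_hom_mono.
  apply/eqP; rewrite -subv0; apply/subvP => _ /memv_imgP[x _ ->].
  by rewrite lfun_valE mem0v.
exists (dsum (nseq (size fs) Z)), (hcomp (htuple fs) (hquot (immod basis_hom))); split=> //.
- exact: in_add_power.
- exact: homP.
apply/exactP => y; rewrite -ex hcompE; split=> [h|->]; last exact: hom0.
apply: contrapT => qy; have [f] := dfil_cogen (proj1 tZ) cZ basis_coker qy; apply.
apply: fsP => i si; have [p pE] := htuple_proj si.
by rewrite -pE h hom0.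
Qed.

End Star.

(** * Weights carried by a faithful tilting module *)

Lemma split_summand l X Z (i : hom X Z) (p : hom Z X) : (forall x, p (i x) = x) ->
  split l X -> split l Z.
Proof.
move=> pi' [h [f fh]]; exists (hcomp i h), (hcomp f p) => x.
by rewrite !hcompE pi' fh.
Qed.

Lemma split_iso l X Z : hiso X Z -> split l X -> split l Z.
Proof. by move=> [f [g [gf _]]]; apply: split_summand gf. Qed.

Lemma split_prod l X Y : split l (prodM X Y) -> split l X \/ split l Y.
Proof.
move=> [h [f fh]]; apply: contrapT => /not_orP[nX nY].
have [x x0] : exists x : delta l, x <> 0.
  have [z z0] := L_nz l; have [x qx] := @delta_q_epi l z.
  by exists x => x0; apply: z0; rewrite -qx x0 hom0.
apply/x0/(@env_in_mono l); rewrite -fh.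
have -> : h x = hinl X Y (hfst X Y (h x)) + hinr X Y (hsnd X Y (h x)).
  rewrite hinlE hinrE hfstE hsndE {1}(surjective_pairing (h x)).
  by congr pair; rewrite ?addr0 ?add0r.
rewrite homD -!(hcompE f) -(hcompE (hfst X Y)) -(hcompE (hsnd X Y)).
by rewrite !nonsplit // addr0.
Qed.

Lemma split_prodl l X Y : split l X -> split l (prodM X Y).
Proof. by apply: (@split_summand l X _ (hinl X Y) (hfst X Y)) => x; rewrite hinlE hfstE. Qed.

Lemma split_prodr l X Y : split l Y -> split l (prodM X Y).
Proof. by apply: (@split_summand l Y _ (hinr X Y) (hsnd X Y)) => x; rewrite hinrE hsndE. Qed.

Lemma split_env l : split l (env l).
Proof. by exists (env_in l), (hid _) => x; rewrite hidE. Qed.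

Lemma split_env_le l m : split l (env m) -> (l <= m)%O.
Proof.
move=> [h [f fh]]; apply: contraT => lm.
have [z z0] := L_nz l; have [x qx] := @delta_q_epi l z.
case: z0; rewrite -qx; suff -> : x = 0 by rewrite hom0.
apply: (@env_in_mono l); rewrite -fh hom_delta0 ?hom0 //; exact: nosupp_env.
Qed.

Lemma split_dsum l (s : seq Lam) : split l (dsum [seq env m | m <- s]) ->
  exists2 m, m \in s & split l (env m).
Proof.
elim: s => [|m s IH] /= => [[h [f fh]]|/split_prod[sm|/IH[k ks sk]]].
- have [z z0] := L_nz l; have [x qx] := @delta_q_epi l z.
  case: z0; rewrite -qx; suff -> : x = 0 by rewrite hom0.
  apply: (@env_in_mono l); rewrite -fh; have -> : h x = 0 by apply/rowP; case.
  exact: hom0.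
- by exists m => //; apply: mem_head.
by exists k => //; rewrite inE ks orbT.
Qed.

Lemma dsum_split l (s : seq Lam) : l \in s -> split l (dsum [seq env m | m <- s]).
Proof.
elim: s => // m s IH; rewrite inE /= => /orP[/eqP->|/IH].
  by apply: split_prodl; apply: split_env.
exact: split_prodr.
Qed.

Lemma tilt_dsum_env (s : seq Lam) : tilt (dsum [seq env m | m <- s]).
Proof.
elim: s => [|m s IH] /=; first exact: tilt_zero.
by apply: tilt_prod => //; apply: tilt_env.
Qed.

(** g0 r - k g0 kills Delta(l), hence factors through C, whose weights are below l and admit no map
    to nab(l). So one scalar serves both ends. *)
Lemma hom_env_scalar l (g0 : hom (env l) (nab l)) (r : hom (env l) (env l)) :
  exists k : K, (forall x, r (env_in l x) = k *: env_in l x) /\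
    (forall y, g0 (r y) = k *: g0 y).
Proof.
have [k kE] := hom_delta_env (hcomp r (env_in l)).
exists k; split=> [x|y]; first by rewrite -kE hcompE.
have [C [p [[mi ep ex] fC]]] := env_ses l.
pose g := hsub (hcomp g0 r) (hscale k g0).
have [g' g'E] : exists g' : hom C (nab l), forall y, g' (p y) = g y.
  apply: factor_epi => // z /ex[x <-].
  by rewrite hsubE hscaleE hcompE -(hcompE r) kE homZ subrr.
apply/eqP; rewrite -subr_eq0 -hcompE -hscaleE -hsubE -g'E; apply/eqP.
apply: fil_hom0 fC _ _ => _ [m ml ->] f x.
by apply: hom_delta_nab0 => e; rewrite e ltxx in ml.
Qed.

Lemma rank_one (V W : vectType K) (v : V) (w : W) : v <> 0 ->
  exists f : 'Hom(V, W), f v = w.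
Proof.
move=> v0.
pose X := vbasis {:V}.
have [i vi] : exists i, coord X i v != 0.
  apply: contrapT => h; apply: v0; rewrite (coord_vbasis (memvf v)) big1 // => i _.
  have [->|vi] := eqVneq (coord X i v) 0; first by rewrite scale0r.
  by case: h; exists i.
pose f x := (coord X i x / coord X i v) *: w.
have lf : linear f by move=> k x y; rewrite /f linearP /= mulrDl scalerDl -mulrA scalerA.
by exists (linfun f); rewrite (linfunE lf) /f divff // scale1r.
Qed.

(* If some core l is missing from T, take l maximal, complete T by envelopes to
   Z = env l + Z' where Z' still misses l, and let a be the map
     env l -> nab l -> D A -> A -> Delta(l) -> env l,
   zero on Z', where A -> Delta(l) hits the socle element u, nab l -> D A is its
   dual and D A -> A is an arbitrary K-linear map.  It commutes with End(Z), because
   maps between env l and Z' annihilate u or its dual and endomorphisms of env l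
   act by one scalar on both ends.  By the double centralizer property of Z it is
   the action of an element of A, which kills T. *)
Lemma faithful_split T : tilt T -> faithful T -> forall l, core l -> split l T.
Proof.
move=> tT faT l0 cl0; apply: contrapT => nsl0.
pose S l := `[< core l /\ ~ split l T >].
have [l /asboolP[[u su] nsl] lmax] : exists2 j, S j & forall k, S k -> ~~ (j < k)%O.
  by apply: (@max_elem S l0); apply/asboolP.
pose s := [seq m <- enum Lam | S m && (m != l)].
pose Z' := prodM T (dsum [seq env m | m <- s]).
pose Z := prodM (env l) Z'.
have tZ' : tilt Z' by apply: tilt_prod => //; apply: tilt_dsum_env.
have tZ : tilt Z by apply: tilt_prod => //; apply: tilt_env.
have nsZ' : ~ split l Z'.
  case/split_prod=> // /split_dsum[m]; rewrite mem_filter => /andP[/andP[Sm ml] _].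
  move=> /split_env_le; rewrite le_eqVlt eq_sym (negPf ml) /= => lm.
  by have := lmax m Sm; rewrite lm.
have nsDZ' : ~ split l (D Z').
  by move=> /(split_D (tilt_D tZ')) /(split_iso (hiso_sym (iso_DD Z'))).
have splZ m : core m -> split m Z.
  move=> cm; have [sT|nT] := pselect (split m T).
    by apply/split_prodr/split_prodl.
  have [->|ml] := eqVneq m l; first exact/split_prodl/split_env.
  apply/split_prodr/split_prodr/dsum_split.
  by rewrite mem_filter ml mem_enum andbT; apply/andP; split=> //; apply/asboolP.
have actZ b (t : T) : act Z b (0, (t, 0)) = (0, (act T b t, 0)).
  by rewrite !prodM_actE /= !linear0.
have faZ : faithful Z.
  move=> b c bc; apply: faT; apply/lfunP => t.
  have := congr1 (fun f : 'End(Z) => (f (0, (t, 0))).2.1) bc.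
  by rewrite !actZ.
have dcZ : double_centralizer Z.
  apply: tilt_double_centralizer => //; first exact: split_cogen.
  by apply: split_cogen; [exact: tilt_D | move=> m /splZ; exact: split_D].
have [j jE] := reg_hom u.
have killj Y (h : hom (delta l) Y) : tilt Y -> ~ split l Y -> forall a, h (j a) = 0.
  by move=> tY nY a; rewrite jE homA (sock_kill h su) // linear0.
have [c [[x0 cx0] _]] := delta_nab_ex l.
have [g0 g0E] := env_extend c (fun m => @ext0_delta_nab m l).
(* The dual of [killj]: D Z' misses l as well. *)
have g0r (r : hom Z' (nab l)) z : Dm j (r z) = 0.
  rewrite -hcompE; apply: Dm_faith0 => y; have [a <-] := eta_epi y.
  rewrite Dm_comp -eta_nat -hcompE.
  by apply: killj => //; apply: tilt_D.
(* Otherwise the map [h1] : Delta(l) -> D (env l) dual to [g0] kills u; but it is nonzero and l is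
   the maximal weight of its target, so it is injective. *)
have [x1 x1P] : exists x, Dm j (g0 x) <> 0.
  apply: contrapT => h.
  have jg x : Dm j (g0 x) = 0 by apply: contrapT => jg; apply: h; exists x.
  pose h1 := hcomp (Dm g0) (eta (delta l)).
  have [y h1y] : exists y, h1 y <> 0.
    apply: contrapT => h1z; apply: cx0; rewrite -g0E; apply: Dm_faith0 => y.
    have [w <-] := eta_epi y; apply: contrapT => w0; apply: h1z; exists w.
    by rewrite hcompE.
  have [C [p [[mh1 _ _] _]]] : exists (C : fdmod A) (p : hom (D (env l)) C),
      ses h1 p /\ dfil predT C.
    apply: delta_sub_max h1y; first by case: (tilt_D (tilt_env l)).
    by move=> k lk; apply/nosupp_D/nosupp_env; rewrite lt_geF.
  case: su => u0 _; apply/u0/mh1.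
  have <- : j (1 : A) = u by rewrite jE act1 lfun_valE.
  rewrite hcompE eta_nat -Dm_comp; apply: Dm_0 => x; by rewrite hcompE.
(* This choice makes B x1 = j 1 = u. *)
have [phi phiE] := rank_one (1 : regM A) x1P.
pose B x := j (phi (Dm j (g0 x))).
have BD x y : B (x + y) = B x + B y.
  rewrite /B (homD g0) (homD (Dm j)) -(homD j).
  by congr (hom_fun j _); apply: linearD.
have BZ (k : K) x : B (k *: x) = k *: B x.
  rewrite /B (homZ g0) (homZ (Dm j)) -(homZ j).
  by congr (hom_fun j _); apply: linearZ.
have [a aE] : exists a : 'End(Z), forall z, a z = (env_in l (B z.1), 0).
  exists (hinl (env l) Z' \o
    (env_in l \o (j \o (phi \o (Dm j \o (g0 \o hfst (env l) Z'))))))%VF => z.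
  by rewrite !comp_lfunE hinlE hfstE.
(* In block form on env l + Z', [r12] is killed by [g0r] and [r21] by [killj], while [r11] gives the
   same scalar k on both sides. *)
have ac (f : 'End(Z)) : is_hom f -> (a \o f)%VF = (f \o a)%VF.
  move=> hf; apply/lfunP => z; rewrite !comp_lfunE !aE.
  pose F : hom Z Z := MkHom hf.
  pose r11 := hcomp (hfst _ _) (hcomp F (hinl (env l) Z')).
  pose r12 := hcomp (hfst _ _) (hcomp F (hinr (env l) Z')).
  pose r21 := hcomp (hsnd _ _) (hcomp F (hinl (env l) Z')).
  have [k [k1 k2]] := hom_env_scalar g0 r11.
  have -> : (f z).1 = r11 z.1 + r12 z.2.
    have zE : (z.1, 0) + (0, z.2) = z :> Z.
      by case: (z) => z1 z2; congr pair; rewrite ?addr0 ?add0r.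
    by rewrite !hcompE -homD -homD hfstE hinlE hinrE zE.
  have -> : f (env_in l (B z.1), 0) = (r11 (env_in l (B z.1)), r21 (env_in l (B z.1))).
    by rewrite !hcompE hfstE hsndE hinlE -surjective_pairing.
  have -> : B (r11 z.1 + r12 z.2) = k *: B z.1.
    rewrite BD -BZ /B -(hcompE g0 r12) g0r linear0 hom0 addr0.
    by rewrite k2 (homZ g0).
  by rewrite k1 homZ -(hcompE r21) [hcomp r21 _ _]killj.
have [b ab] := dcZ a ac.
have b0 : b = 0.
  apply: faT; rewrite linear0; apply/lfunP => t; rewrite lfun_valE.
  have := congr1 (fun f : 'End(Z) => (f (0, (t, 0))).2.1) ab.
  by rewrite actZ aE.
case: su => u0 _; apply/u0/(@env_in_mono l).
have := congr1 (fun f : 'End(Z) => (f (x1, 0)).1) ab.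
by rewrite b0 linear0 lfun_valE aE /= /B phiE jE act1 lfun_valE.
Qed.

Lemma faithful_tilt_double_centralizer T : tilt T -> faithful T ->
  double_centralizer T /\ coresolution T (regM A) 2.
Proof.
move=> tT faT; have sT := faithful_split tT faT.
have cT : cogen T by apply: split_cogen.
have cDT : cogen (D T).
  by apply: split_cogen => [|l /sT]; [exact: tilt_D | exact: split_D].
by split; [exact: tilt_double_centralizer | exact: tilt_coresolution].
Qed.

(** * Composition series and the given costandard modules *)

Lemma factor_supp m M s : filtration L M s -> m \in s -> ~ nosupp m M.
Proof.
elim=> {M s} // M U i s /hisoP iL _ IH; rewrite inE => /orP[/eqP->|ms] nM.
  have nL : nosupp i (L i).
    by apply: nosupp_iso iL _; apply: nosupp_quot nM; exact: hquot_epi.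
  have [z z0] := L_nz i; have [x ex] := @epsh_epi i z.
  by apply: z0; rewrite -ex nL.
by apply: IH ms _; apply: nosupp_sub nM; exact: hincl_mono.
Qed.

(** A simple quotient is peeled off the top. If it is L(m), any series of the kernel will do;
    otherwise the kernel must supply one containing m. Hence the conjunction. *)
Lemma comp_series M : (exists s, filtration L M s) /\
  forall m, ~ nosupp m M -> comp_factor L M m.
Proof.
have [n] := ubnP (\dim {:M}); elim: n M => // n IH M Mn.
have [M0|] := pselect (forall m : M, m = 0).
  split=> [|m]; last by case=> f x; apply: M0.
  exists [::]; apply: FiltZero; apply/eqP; rewrite -subv0; apply/subvP => x _.
  by rewrite (M0 x) mem0v.
case/existsNP=> x x0; have [l [f ef]] := simple_quot x0.
pose U := kermod f; have sU := sub_ses U.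
have iU : iso (quotM U) (L l).
  have [g gE] : exists g : hom (quotM U) (L l), forall x, g (hquot U x) = f x.
    apply: factor_epi; first exact: hquot_epi.
    by move=> y /hquot0 /hincl_im /(hker_ex f).
  have eg : epi g by move=> z; have [y <-] := ef z; exists (hquot U y).
  have mg : mono g.
    move=> y; have [w <-] := hquot_epi y; rewrite gE => /(hker_ex f) h.
    exact/hquot0/hincl_im.
  by apply/hisoP; have [g' [h1 h2]] := hiso_inv mg eg; exists g, g'.
have ltU : (\dim {:subM U} < n)%N.
  rewrite -ltnS; apply: (leq_trans _ Mn); rewrite ltnS (ses_dim sU).
  rewrite -[X in (X < _)%N]addn0 ltn_add2l.
  have [w w0] := L_nz l; have [y yw] := ef w.
  apply: (@dim_gt0 _ _ _ (hquot U y)) => /hquot0 /hincl_im /(hker_ex f) fy.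
  by apply: w0; rewrite -yw.
have [[s fs] hU] := IH _ ltU.
split=> [|m nm]; first by exists (l :: s); apply: FiltStep iU fs.
have [->|ml] := eqVneq m l.
  by exists (l :: s); [apply: FiltStep iU fs | apply: mem_head].
have [|s' fs' ms'] := hU m.
  move=> nU; apply: nm; apply: nosupp_ext sU nU _.
  by apply: nosupp_iso (hiso_sym (proj1 (hisoP _ _) iU)) _; apply: nosupp_L; apply/eqP.
by exists (l :: s'); [apply: FiltStep iU fs' | rewrite inE ms' orbT].
Qed.

Lemma nosupp_factor m M : nosupp m M <-> ~ comp_factor L M m.
Proof.
split=> [nM [s fs ms]|nf]; first exact: factor_supp fs ms nM.
by apply: contrapT => /(proj2 (comp_series M) m).
Qed.

(** Injectivity of I(l) extends f to g on Y. For k > l a map from P(k) to the image of g lifts to Y,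
    lands in X as M has no factor L(k), and dies in U. By maximality U contains the image of g. *)
Lemma ext0_costandard (I : Lam -> fdmod A) l (U : submod (I l)) M :
  injective_mod (I l) -> is_costandard L U ->
  (forall k, (l < k)%O -> nosupp k M) -> ext0 M (subM U).
Proof.
move=> injI [nU maxU] nM X Y i p [mi ep exi] f.
have [g0 hg0 g0E] :=
  injI _ _ _ _ (homP i) (proj1 (monoP i) mi) (homP (hcomp (hincl U) f)).
pose g : hom Y (I l) := MkHom hg0.
have gE x : g (i x) = hincl U (f x).
  by have /lfunP/(_ x) := g0E; rewrite comp_lfunE => ->; apply: hcompE.
have sub : (immod g <= U)%VS.
  apply: maxU => k lk; apply/nosupp_factor => h x.
  pose j := hincl (immod g).
  have mj : mono j by exact: hincl_mono.
  have [r rE] : exists r : hom Y (subM (immod g)), forall y, j (r y) = g y.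
    by apply: factor_mono => // y; apply/hincl_im/immodP; exists y.
  have er : epi r.
    move=> v; have /immodP[y yE] : j v \in limg g by apply/(hincl_im (immod g)); exists v.
    by exists y; apply: (mono_inj mj); rewrite rE.
  have [w wE] := proj_lift h (@projP k) er.
  have [w' w'E] : exists w' : hom (P k) X, forall y, i (w' y) = w y.
    by apply: factor_mono => // y; apply/exi; rewrite -hcompE nM.
  apply: mj; rewrite -wE rE -w'E gE -(hcompE f).
  by have /nosupp_factor -> := nU k lk; rewrite ?hom0.
have [g' g'E] : exists g' : hom Y (subM U), forall y, hincl U (g' y) = g y.
  apply: factor_mono; first exact: hincl_mono.
  by move=> y; apply/hincl_im/(subvP sub)/immodP; exists y.
by exists g' => x; apply: (mono_inj (@hincl_mono _ _ _ U)); rewrite g'E gE.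
Qed.

(** Ext^1(Delta(m), nabla(l)) = 0: if l < m by the bound on the factors of nabla(l), otherwise by
    [ext0_costandard]. *)
Lemma tilting_tilt (I : Lam -> fdmod A) (nabla : forall l, submod (I l)) T :
  (forall l, injective_mod (I l)) -> (forall l, is_costandard L (nabla l)) ->
  tilting P nabla T -> tilt T.
Proof.
move=> injI cn [[s fs] [s' fs']]; split=> m.
  apply: fil_ext0_r (filtration_fil fs' (all_predT s')) => _ [l _ ->].
  have [lm|lm] := boolP (l < m)%O; last first.
    apply: ext0_costandard => // k lk; apply: nosupp_delta.
    by apply: contra lm => /(lt_le_trans lk).
  apply: ext0_delta => k mk; apply/nosupp_factor; case: (cn l) => h _; apply: h.
  exact: lt_trans lm mk.
apply: dfil_ext0 (filtration_fil fs (all_predT s)) => l _; exact: ext0_delta_nab.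
Qed.

End HighestWeightDuality.

Lemma dualityP (K : fieldType) (A : falgType K) (D : contrafunctor A) :
  involutive_functor D ->
  exists eta : forall M, hom M (D (D M)),
    [/\ forall M, mono (eta M), forall M, epi (eta M)
      & forall M N (f : hom M N) x, eta N (f x) = Dm D (Dm D f) (eta M x)].
Proof.
move=> [eta [h nat]].
have hh M : is_hom (eta M) by case: (h M).
exists (fun M => MkHom (hh M)); split=> [M|M|M N f x] /=.
- by apply/monoP; case: (h M).
- by apply/epiP; case: (h M).
by have /lfunP/(_ x) := nat _ _ _ (homP f); rewrite !lfun_valE.
Qed.

Local Close Scope ring_scope.

Theorem theorem1p10 (K : fieldType) (A : falgType K)
    (d : Order.disp_t) (Lam : finPOrderType d)
    (L P I : Lam -> fdmod A)
    (eps : forall l : Lam, 'Hom(P l, L l))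
    (iota : forall l : Lam, 'Hom(L l, I l))
    (nabla : forall l : Lam, submod (I l))
    (D : contrafunctor A) (T : fdmod A) :
  complete_simples L ->
  (forall l : Lam, End_is_scalar (L l)) ->
  (forall l : Lam, projective_cover (eps l)) ->
  (forall l : Lam, injective_hull (iota l)) ->
  quasi_hereditary eps ->
  (forall l : Lam, is_costandard L (nabla l)) ->
  simple_preserving_duality D ->
  tilting P nabla T ->
  faithful T ->
  double_centralizer T /\ enat_le (Some 2) (domdim T (regM A)).
Proof.
move=> cL sL cP hI qh cn [exD /dualityP[eta [m e nat]] eqD sD] tT fT.
have injI l : injective_mod (I l) by case: (hI l).
have tT' := tilting_tilt exD eqD m e cL cP qh sD injI cn tT.
have [dc cr] := faithful_tilt_double_centralizer exD eqD m e nat cL sL cP qh sD tT' fT.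
by split=> //; apply: (proj1 (domdimP T (regM A)) 2).
Qed.
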